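(* Let $\Phi:\mathcal P_2(\mathbb R^d)\to\mathbb R\cup\{+\infty\}$ be a proper geodesically convex functional such that every $\mu\in\operatorname{dom}\Phi$ is absolutely continuous with respect to Lebesgue measure. Assume that $\operatorname*{arg\,min}_{\nu\in\mathcal P_2(\mathbb R^d)}\Phi(\nu)\ne\emptyset$ and that there exists $\tau>0$ such that $J_\tau^\Phi(\mu)\neq\emptyset$ for every $\mu\in\operatorname{dom}\Phi$. Then the following statements are equivalent. (i) There exists $\kappa>0$ such that $$W_2\Big(\mu,\operatorname*{arg\,min}_{\nu\in\mathcal P_2(\mathbb R^d)}\Phi(\nu)\Big)\le\kappa\, d_{L^2}\big(0,\partial\Phi(\mu)\big)\qquad\forall\mu\in\mathcal P_2(\mathbb R^d).$$ (ii) There exists $c>0$ such that $$\Phi(\mu)\ge\inf_{\nu\in\mathcal P_2(\mathbb R^d)}\Phi(\nu)+c\,W_2\Big(\mu,\operatorname*{arg\,min}_{\nu\in\mathcal P_2(\mathbb R^d)}\Phi(\nu)\Big)^2\qquad\forall\mu\in\mathcal P_2(\mathbb R^d).$$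
   Context: $\mathcal P_2(\mathbb R^d)$ is the set of Borel probability measures on $\mathbb R^d$ with finite second moment, with the Wasserstein distance $$W_2(\mu,\nu):=\inf_{\gamma\in\Gamma(\mu,\nu)}\Big(\int_{\mathbb R^d\times\mathbb R^d}|x-y|^2\,d\gamma(x,y)\Big)^{1/2},$$ where $\Gamma(\mu,\nu)$ is the set of couplings of $\mu$ and $\nu$; $\Gamma_o(\mu,\nu)$ denotes the (nonempty) set of couplings attaining the infimum. Constant-speed geodesics in this space are the curves $\gamma(t)=((1-t)\operatorname{proj}_1+t\operatorname{proj}_2)_{\#}\pi$, $t\in[0,1]$, with $\pi\in\Gamma_o(\mu,\nu)$. $\operatorname{dom}\Phi=\{\mu:\Phi(\mu)<+\infty\}$; $\Phi$ is proper if $\operatorname{dom}\Phi\neq\emptyset$. $\Phi$ is geodesically convex if for all $\mu,\nu\in\mathcal P_2(\mathbb R^d)$ there is at least one constant-speed geodesic $\gamma$ with $\gamma(0)=\mu$, $\gamma(1)=\nu$ such that $\Phi(\gamma(t))\le(1-t)\Phi(\mu)+t\Phi(\nu)$ for all $t\in[0,1]$. For $\mu,\nu\in\operatorname{dom}\Phi$ (so both absolutely continuous), $\mathfrak t_\mu^\nu:\mathbb R^d\to\mathbb R^d$ denotes the ($\mu$-a.e. unique) optimal transport map from $\mu$ to $\nu$, i.e. the Borel map with $(\operatorname{id},\mathfrak t_\mu^\nu)_{\#}\mu\in\Gamma_o(\mu,\nu)$. $L^2(\mu)^d$ is the space of $\mu$-square-integrable Borel vector fields $\mathbb R^d\to\mathbb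 R^d$. For $\tau>0$, $$J_\tau^\Phi(\mu):=\operatorname*{arg\,min}_{\nu\in\mathcal P_2(\mathbb R^d)}\Big\{\Phi(\nu)+\frac1{2\tau}W_2(\nu,\mu)^2\Big\}.$$ The subdifferential $\partial\Phi(\mu)$ of $\Phi$ at $\mu\in\operatorname{dom}\Phi$ consists of all $\xi\in L^2(\mu)^d$ such that $$\Phi(\nu)\ge\Phi(\mu)+\int_{\mathbb R^d}\langle\xi(x),\mathfrak t_\mu^\nu(x)-x\rangle\,d\mu(x)\qquad\forall\nu\in\mathcal P_2(\mathbb R^d)$$ (the inequality is regarded as trivially true when $\Phi(\nu)=+\infty$); $\partial\Phi(\mu)=\emptyset$ if $\mu\notin\operatorname{dom}\Phi$. For $C\subseteq\mathcal P_2(\mathbb R^d)$, $W_2(\mu,C):=\inf_{\nu\in C}W_2(\mu,\nu)$, and $d_{L^2}(0,\partial\Phi(\mu)):=\inf_{\xi\in\partial\Phi(\mu)}\|\xi\|_{L^2(\mu)^d}$, with $\inf\emptyset=+\infty$. *)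

(* Defs.v *)
From HB Require Import structures.
From mathcomp Require Import all_boot all_order all_algebra.
From mathcomp Require Import all_classical all_reals all_analysis.

Set Implicit Arguments.
Unset Strict Implicit.
Unset Printing Implicit Defensive.

Import Order.TTheory GRing.Theory Num.Theory.
Import numFieldTopology.Exports numFieldNormedType.Exports.

Local Open Scope classical_set_scope.
Local Open Scope ring_scope.

(* R^d is 'rV[R]_d with its Borel sigma-algebra. *)
HB.instance Definition _ (R : realType) (d : nat) :=
  @isMeasurable.Build (sigma_display (@open 'rV[R]_d)) 'rV[R]_d
    <<s @open 'rV[R]_d >> (@sigma_algebra0 _ setT _) (@sigma_algebraC _ _)
    (@sigma_algebra_bigcup _ setT _).

Section euclidean.
Context {R : realType} {d : nat}.
Implicit Types x y : 'rV[R]_d.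

Definition dotp x y : R := \sum_(i < d) x ord0 i * y ord0 i.

(* The norm that the library puts on 'rV[R]_d is the sup norm. *)
Definition enorm x : R := Num.sqrt (dotp x x).

Definition box x y : set 'rV[R]_d :=
  [set z : 'rV[R]_d | forall i, x ord0 i < z ord0 i <= y ord0 i].

Definition box_volume x y : R :=
  \prod_(i < d) Num.max 0 (y ord0 i - x ord0 i).

(* The d-dimensional Lebesgue (outer) measure, by countable covers (the
   predicate K selects the boxes that are used, so that a cover may be finite
   or empty). On Borel sets it is the Lebesgue measure. *)
Definition lebesgue_rV (A : set 'rV[R]_d) : \bar R :=
  ereal_inf [set s : \bar R |
    exists (K : pred nat) (a b : nat -> 'rV[R]_d),
      A `<=` \bigcup_(k in [set k | K k]) box (a k) (b k) /\
      s = (\sum_(0 <= k <oo | K k) (box_volume (a k) (b k))%:E)%E].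

End euclidean.

(* Two inhabitants of [P2 R d] are the same Borel measure when they are related
   by the library's [measure_eq]: a measure of the library is a function on all
   sets, whose values outside the sigma-algebra carry no information. *)
Record P2 (R : realType) (d : nat) := MkP2 {
  P2_prob :> probability 'rV[R]_d R ;
  P2_moment : (\int[P2_prob]_x ((enorm x) ^+ 2)%:E < +oo)%E }.

Section wasserstein.
Context {R : realType} {d : nat}.
Local Notation V := 'rV[R]_d.
Local Open Scope ereal_scope.

Definition coupling (mu nu : P2 R d) : set (probability (V * V)%type R) :=
  [set g | forall A : set V, measurable A ->
     pushforward g fst A = mu A /\ pushforward g snd A = nu A].

Definition transport_cost (g : probability (V * V)%type R) : \bar R :=
  sqrte (\int[g]_p ((enorm (p.1 - p.2)) ^+ 2)%:E).

Definition W2 (mu nu : P2 R d) : \bar R :=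
  ereal_inf [set transport_cost g | g in coupling mu nu].

Definition W2_set (mu : P2 R d) (C : set (P2 R d)) : \bar R :=
  ereal_inf [set W2 mu nu | nu in C].

Definition optimal_coupling (mu nu : P2 R d) :
    set (probability (V * V)%type R) :=
  [set g | coupling mu nu g /\ transport_cost g = W2 mu nu].

(* Only the values of [gamma] on [0, 1] are relevant. *)
Definition geodesic (mu nu : P2 R d) (gamma : R -> P2 R d) : Prop :=
  exists2 g, optimal_coupling mu nu g &
    forall t : R, (0 <= t <= 1)%R ->
    forall A : set V, measurable A ->
      gamma t A = pushforward g (fun p => (1 - t) *: p.1 + t *: p.2)%R A.

Definition is_transport_map (mu nu : P2 R d) : set (V -> V) :=
  [set f | measurable_fun [set: V] f /\
    exists2 g, optimal_coupling mu nu g &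
      forall A : set (V * V), measurable A ->
        g A = pushforward mu (fun x => (x, f x)) A].

(* The default value [idfun] is not reached when [mu] is absolutely continuous,
   by Brenier's theorem; the map is then unique up to [mu]-null sets. *)
Definition transport_map (mu nu : P2 R d) : V -> V :=
  xget (idfun : V -> V) (is_transport_map mu nu).

Definition L2norm (mu : P2 R d) (xi : V -> V) : \bar R :=
  Lnorm mu 2%:E (fun x => (enorm (xi x))%:E).

Definition L2 (mu : P2 R d) : set (V -> V) :=
  [set xi | measurable_fun [set: V] xi /\ L2norm mu xi < +oo].

Definition absolutely_continuous (mu : P2 R d) : Prop :=
  mu `<< @lebesgue_rV R d.

Definition argmin (F : P2 R d -> \bar R) : set (P2 R d) :=
  [set nu | forall rho, F nu <= F rho].

Variable Phi : P2 R d -> \bar R.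

Definition dom : set (P2 R d) := [set mu | Phi mu < +oo].

(* The conventions 0 * +oo = 0 and r + +oo = +oo apply. *)
Definition geodesically_convex : Prop :=
  forall mu nu : P2 R d, exists2 gamma, geodesic mu nu gamma &
    forall t : R, (0 <= t <= 1)%R ->
      Phi (gamma t) <= (1 - t)%:E * Phi mu + t%:E * Phi nu.

Definition prox (tau : R) (mu : P2 R d) : set (P2 R d) :=
  argmin (fun nu => Phi nu + ((2 * tau)^-1)%:E * W2 nu mu ^+ 2).

Definition subdifferential (mu : P2 R d) : set (V -> V) :=
  [set xi | [/\ dom mu, L2 mu xi & forall nu : P2 R d,
     Phi mu + \int[mu]_x (dotp (xi x) (transport_map mu nu x - x))%:E
       <= Phi nu]].

Definition dist0_subdifferential (mu : P2 R d) : \bar R :=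
  ereal_inf [set L2norm mu xi | xi in subdifferential mu].

End wasserstein.

(* Main.v *)
From HB Require Import structures.
Require Import Defs.
From mathcomp Require Import all_boot all_order all_algebra.
From mathcomp Require Import all_classical all_reals all_analysis.
From mathcomp Require Import giry.
From mathcomp Require Import measurable_realfun ring lra.

(* (i) => (ii) takes a single proximal step: if mu1 minimizes
   Phi + W2(., mu0)^2 / (2 tau) and S is the optimal map from mu1 to mu0, then
   (S - id) / tau is a subgradient at mu1, so (i) bounds the distance from mu1
   to the minimizers by kappa / tau * W2(mu1, mu0), while the step itself costs
   Phi(mu0) - Phi(mu1) >= W2(mu1, mu0)^2 / (2 tau). (ii) => (i) bounds the
   subgradient inequality at a minimizer by completing a square.

   That (S - id) / tau is a subgradient rests on Brenier's theorem: an optimal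
   plan starting from an absolutely continuous measure is unique and induced by
   a map. No Kantorovich potential is used. If g is optimal, exchanging the
   second coordinates of two independent samples of g whenever they are crossed
   gives a competitor, so crossed pairs are (g x g)-null and the support of g is
   a monotone set. The points with two separated images in a monotone set lie on
   countably many Lipschitz graphs, which are Lebesgue-null. Optimal plans exist
   because Phi is geodesically convex. *)

Set Implicit Arguments.
Unset Strict Implicit.
Unset Printing Implicit Defensive.

Import Order.TTheory GRing.Theory Num.Theory.
Import numFieldTopology.Exports numFieldNormedType.Exports.

Local Open Scope classical_set_scope.
Local Open Scope ring_scope.

(** * Borel sets and inner product of R^d *)

Section borel_rV.
Context {R : realType} {d : nat}.
Local Notation V := 'rV[R]_d.

Lemma open_measurable_rV (A : set V) : open A -> measurable A.
Proof. exact: sub_sigma_algebra. Qed.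

Lemma closed_measurable_rV (A : set V) : closed A -> measurable A.
Proof. by move=> /closed_openC/open_measurable_rV/measurableC; rewrite setCK. Qed.

(** Rational centers and radii of the form [1/(n+1)] make the index type countable, so unions over
    these balls preserve measurability. *)
Definition rball (q : 'rV[rat]_d * nat) : set V :=
  ball (map_mx ratr q.1 : V) q.2.+1%:R^-1.

Lemma measurable_rball q : measurable (rball q).
Proof. by apply: open_measurable_rV; exact: ball_open. Qed.

Lemma exists_rball (x : V) (e : R) : 0 < e ->
  exists2 q, rball q x & q.2.+1%:R^-1 < e.
Proof.
move=> e0.
have [n _ /(_ _ (leqnn n)) /= ne] := near_infty_natSinv_lt (PosNum e0).
have n0 : 0 < n.+1%:R^-1 :> R by rewrite invr_gt0 ltr0n.
have /choice[q qP] i : exists r : rat, `|x ord0 i - ratr r| < n.+1%:R^-1.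
  have [|r] := @rat_in_itvoo R (x ord0 i - n.+1%:R^-1) (x ord0 i + n.+1%:R^-1).
    by rewrite ltrBlDr -addrA ltrDl addr_gt0.
  by rewrite in_itv/= => /andP[r1 r2]; exists r; rewrite distrC ltr_distl r1 r2.
exists (\row_i q i, n) => //; split => //= i j.
by rewrite !ord1 !mxE /ball/= distrC; exact: qP.
Qed.

Lemma rball_basis (x : V) (e : R) : 0 < e ->
  exists2 q, rball q x & rball q `<=` ball x e.
Proof.
move=> e0; have [q qx qe] := exists_rball x (divr_gt0 e0 (ltr0n R 2)).
exists q => // y qy; have := ball_triangle (ball_sym qx) qy.
by apply: le_ball; rewrite [leRHS](splitr e); apply: lerD; exact: ltW.
Qed.

Lemma open_bigcup_rball (A : set V) : open A ->
  A = \bigcup_(q in [set q | rball q `<=` A]) rball q.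
Proof.
move=> oA; apply/seteqP; split => [x Ax|x [q qA qx]]; last exact: qA.
have /nbhs_ballP[e /= e0 eA] : nbhs x A by exact: open_nbhs_nbhs.
have [q qx qe] := rball_basis x e0.
by exists q => //=; exact: subset_trans eA.
Qed.

Lemma continuous_measurable_rV (f : V -> R) :
  continuous f -> measurable_fun [set: V] f.
Proof.
move=> cf; apply: (measurability _ (RGenOInfty.measurableE R)) => //.
move=> _ [_ [x ->] <-]; rewrite setTI; apply: open_measurable_rV.
by apply: open_comp => // y _; exact: cf.
Qed.

Lemma measurable_coord (i : 'I_d) :
  measurable_fun [set: V] (fun x : V => x ord0 i).
Proof. by apply: continuous_measurable_rV => x; exact: coord_continuous. Qed.

(** An open set is a countable union of rational balls, and a ball of the sup norm is a finite
    intersection of conditions on single coordinates. *)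
Lemma measurable_fun_rV d' (T : measurableType d') (f : T -> V) :
  (forall i, measurable_fun [set: T] (fun x => f x ord0 i)) ->
  measurable_fun [set: T] f.
Proof.
move=> mf; apply: (@measurability _ _ _ _ _ _ (@open V)) => //.
move=> _ [A oA <-]; rewrite setTI (open_bigcup_rball oA) preimage_bigcup.
rewrite bigcup_mkcond; apply: countable_bigcupT_measurable.
  exact: countableP.
move=> q; case: ifP => // _.
rewrite [X in measurable X](_ : _ = \bigcap_(i : 'I_d)
    (fun x => f x ord0 i) @^-1` ball (ratr (q.1 ord0 i) : R) q.2.+1%:R^-1).
  apply: fin_bigcap_measurable => // i _.
  rewrite -[X in measurable X]setTI; apply: mf => //.
  by apply: open_measurable; exact: ball_open.
apply/seteqP; split => [x [_ /= fx] i _|x /= fx].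
  by have := fx ord0 i; rewrite mxE.
split=> [|i j]; first by rewrite invr_gt0 ltr0n.
by rewrite ord1 mxE; exact: fx.
Qed.

End borel_rV.

Section dotp_theory.
Context {R : realType} {d : nat}.
Local Notation V := 'rV[R]_d.
Implicit Types (x y z : V) (a : R).

Lemma dotpC x y : dotp x y = dotp y x.
Proof. by apply: eq_bigr => i _; rewrite mulrC. Qed.

Lemma dotpDl x y z : dotp (x + y) z = dotp x z + dotp y z.
Proof. by rewrite -big_split; apply: eq_bigr => i _; rewrite mxE mulrDl. Qed.

Lemma dotpZl a x z : dotp (a *: x) z = a * dotp x z.
Proof. by rewrite mulr_sumr; apply: eq_bigr => i _; rewrite mxE mulrA. Qed.

Lemma dotpNl x z : dotp (- x) z = - dotp x z.
Proof. by rewrite -scaleN1r dotpZl mulN1r. Qed.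

Lemma dotpDr x y z : dotp z (x + y) = dotp z x + dotp z y.
Proof. by rewrite !(dotpC z) dotpDl. Qed.

Lemma dotpZr a x z : dotp z (a *: x) = a * dotp z x.
Proof. by rewrite !(dotpC z) dotpZl. Qed.

Lemma dotpNr x z : dotp z (- x) = - dotp z x.
Proof. by rewrite !(dotpC z) dotpNl. Qed.

Definition dotpE := (dotpDl, dotpDr, dotpZl, dotpZr, dotpNl, dotpNr).

Lemma dotp_ge0 x : 0 <= dotp x x.
Proof. by apply: sumr_ge0 => i _; rewrite -expr2 sqr_ge0. Qed.

Lemma sqr_enorm x : enorm x ^+ 2 = dotp x x.
Proof. by rewrite sqr_sqrtr// dotp_ge0. Qed.

(** The last term is what exchanging [y] and [y'] saves in quadratic cost; it is positive exactly
    when the two pairs violate monotonicity. *)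
Lemma dotp_exchange (x y x' y' : V) :
  dotp (x - y) (x - y) + dotp (x' - y') (x' - y') =
  dotp (x - y') (x - y') + dotp (x' - y) (x' - y)
  + - 2 * dotp (x - x') (y - y').
Proof.
rewrite !dotpE (dotpC y x) (dotpC y' x') (dotpC y' x) (dotpC y x').
ring.
Qed.

Lemma dotp_le_half x y : dotp x y <= (dotp x x + dotp y y) / 2.
Proof.
have := dotp_ge0 (x - y); rewrite !dotpE (dotpC y x).
by set u := dotp x x; set v := dotp y y; set w := dotp x y; lra.
Qed.

Lemma normr_dotp_le x y : `|dotp x y| <= (dotp x x + dotp y y) / 2.
Proof.
rewrite ler_norml dotp_le_half andbT lerNl -dotpNl.
by rewrite (le_trans (dotp_le_half _ _))// !dotpE opprK.
Qed.

Lemma measurable_dotp d' (T : measurableType d') (f g : T -> V) :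
  measurable_fun [set: T] f -> measurable_fun [set: T] g ->
  measurable_fun [set: T] (fun t => dotp (f t) (g t)).
Proof.
move=> mf mg; apply: measurable_sum => i; apply: measurable_funM.
  exact: (measurableT_comp (measurable_coord i)).
exact: (measurableT_comp (measurable_coord i)).
Qed.

Lemma measurable_addV d' (T : measurableType d') (f g : T -> V) :
  measurable_fun [set: T] f -> measurable_fun [set: T] g ->
  measurable_fun [set: T] (fun t => f t + g t).
Proof.
move=> mf mg; apply: measurable_fun_rV => i.
under eq_fun do rewrite mxE.
by apply: measurable_funD; exact: (measurableT_comp (measurable_coord i)).
Qed.

Lemma measurable_scaleV d' (T : measurableType d') a (f : T -> V) :
  measurable_fun [set: T] f -> measurable_fun [set: T] (fun t => a *: f t).
Proof.
move=> mf; apply: measurable_fun_rV => i.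
under eq_fun do rewrite mxE.
apply: measurable_funM => //.
exact: (measurableT_comp (measurable_coord i)).
Qed.

Lemma measurable_subV d' (T : measurableType d') (f g : T -> V) :
  measurable_fun [set: T] f -> measurable_fun [set: T] g ->
  measurable_fun [set: T] (fun t => f t - g t).
Proof.
move=> mf mg; under eq_fun do rewrite -scaleN1r.
by apply: measurable_addV => //; exact: measurable_scaleV.
Qed.

End dotp_theory.

(** * Monotonicity of optimal plans *)

Section probability_constructions.
Local Open Scope ereal_scope.
Context d1 d2 (T : measurableType d1) (U : measurableType d2) (R : realType).

Lemma exists_pushforward (P : probability T R) (X : T -> U) :
  measurable_fun [set: T] X ->
  exists Q : probability U R, forall A, Q A = pushforward P X A.
Proof.
move=> mX; pose X' : {mfun T >-> U} := mfun_Sub (mem_set mX).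
by exists (distribution P X').
Qed.

(** Serves uniqueness: two optimal plans are treated at once through their average, whose null sets
    are null for both. *)
Lemma exists_midpoint (P Q : probability T R) :
  exists2 M : probability T R, forall A, M A = (2^-1)%:E * (P A + Q A) &
    forall f : T -> \bar R, measurable_fun [set: T] f -> (forall x, 0 <= f x) ->
      \int[M]_x f x = (2^-1)%:E * (\int[P]_x f x + \int[Q]_x f x).
Proof.
have h : (0 <= 2^-1 :> R)%R by rewrite invr_ge0.
pose m : {measure set T -> \bar R} := mscale (NngNum h) (measure_add P Q).
have mE A : m A = (2^-1)%:E * (P A + Q A) by rewrite -measure_addE.
have m1 : m [set: T] = 1.
  by rewrite mE !probability_setT -EFinD -EFinM mulVf.
pose h1 := Measure_isProbability.Build _ _ _ m m1.
pose M : probability T R := HB.pack (Measure.sort m) h1.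
exists M => // f mf f0.
rewrite (eq_measure_integral m)//.
by rewrite ge0_integral_mscale// ge0_integral_measure_add.
Qed.

End probability_constructions.

Section measure_lemmas.
Local Open Scope ereal_scope.
Context d1 d2 (T : measurableType d1) (U : measurableType d2) (R : realType).

Lemma ge0_integral_map (P : {measure set T -> \bar R})
    (Q : {measure set U -> \bar R}) (X : T -> U) (f : U -> \bar R) :
  measurable_fun [set: T] X ->
  (forall A, measurable A -> Q A = pushforward P X A) ->
  measurable_fun [set: U] f -> (forall y, 0 <= f y) ->
  \int[Q]_y f y = \int[P]_x f (X x).
Proof.
move=> mX QP mf f0; rewrite (eq_measure_integral (pushforward P X)).
  by rewrite ge0_integral_pushforward.
by move=> A mA _; exact: QP.
Qed.

Lemma ge0_integral_prod_fst (P : probability T R) (Q : probability U R)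
    (f : T -> \bar R) :
  measurable_fun [set: T] f -> (forall x, 0 <= f x) ->
  \int[P \x Q]_z f z.1 = \int[P]_x f x.
Proof.
move=> mf f0; rewrite fubini_tonelli1//.
  apply: eq_integral => x _; rewrite /fubini_F/=.
  transitivity (f x * Q [set: U]); first exact: integral_cst.
  by rewrite probability_setT mule1.
exact: (measurableT_comp mf measurable_fst).
Qed.

Lemma ge0_integral_eq0_set (P : {measure set T -> \bar R}) (D : set T)
    (f : T -> \bar R) : measurable D -> measurable_fun [set: T] f ->
  (forall x, D x -> 0 < f x) -> \int[P]_(x in D) f x = 0 -> P D = 0.
Proof.
move=> mD mf f0 If0.
have /ae_eq_integral_abs : measurable_fun D f by exact: measurable_funTS.
move=> /(_ P mD)[+ _].
have -> : \int[P]_(x in D) `|f x| = \int[P]_(x in D) f x.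
  by apply: eq_integral => x /set_mem Dx; rewrite gee0_abs// ltW// f0.
move=> /(_ If0)[N [mN N0 DN]].
apply/eqP; rewrite eq_le measure_ge0 andbT -N0 le_measure ?inE//.
apply: subset_trans DN => x Dx /= /(_ Dx) fx.
by have := f0 _ Dx; rewrite fx ltxx.
Qed.

End measure_lemmas.

(** * Exchange of two independent samples *)

Section swap.
Local Open Scope ereal_scope.

Lemma ge0_integral_swap d1 (T : measurableType d1) (R : realType)
    (P : probability T R) (f : T * T -> \bar R) :
  measurable_fun setT f -> (forall z, 0 <= f z) ->
  \int[P \x P]_z f z = \int[P \x P]_z f (z.2, z.1).
Proof.
move=> mf f0; rewrite fubini_tonelli2// fubini_tonelli1//.
by apply: measurableT_comp => //; exact: measurable_fun_pair.
Qed.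

Lemma product_measure_swap d1 (T : measurableType d1) (R : realType)
    (P : probability T R) (A : set (T * T)) : measurable A ->
  (P \x P) A = (P \x P) [set z | A (z.2, z.1)].
Proof.
move=> mA.
have msw : measurable_fun setT (fun z : T * T => (z.2, z.1)).
  exact: measurable_fun_pair.
have mB : measurable [set z | A (z.2, z.1)].
  by rewrite -[X in measurable X]setTI; exact: msw.
rewrite -[A in LHS]setIT -[X in _ = _ X]setIT.
rewrite -!integral_indic// (ge0_integral_swap P)//.
  by apply/measurable_EFinP.
Qed.

End swap.

Section swap_gain.
Local Open Scope ereal_scope.
Context d1 (T : measurableType d1) (R : realType).
Variables (P : probability T R) (s : T * T -> bool).
Hypotheses (ms : measurable_fun setT s)
  (s_sym : forall z, s (z.2, z.1) = s z).

Let S : set (T * T) := [set z | s z].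

Lemma measurable_swap_gain_set : measurable S.
Proof. by move: ms => /(_ measurableT [set true] I); rewrite setTI. Qed.

Lemma integral_swap_set (h : T * T -> \bar R) :
  measurable_fun setT h -> (forall z, 0 <= h z) ->
  \int[P \x P]_(z in S) h z = \int[P \x P]_(z in S) h (z.2, z.1).
Proof.
move=> mh h0; rewrite integral_mkcond ge0_integral_swap.
- rewrite [RHS]integral_mkcond; apply: eq_integral => z _; rewrite !patchE.
  rewrite (_ : ((z.2, z.1) \in S) = (z \in S))//.
  by apply/idP/idP; rewrite !inE /S/= s_sym.
- apply/(measurable_restrictT h measurable_swap_gain_set).
  exact: measurable_funTS.
- by move=> z; rewrite patchE; case: ifP.
Qed.

(* Read [a] and [b] as the costs of the original and of the exchanged pairing;
   [e] is the gain of the exchange, symmetrized over the two samples. *)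
Lemma swap_gain_null (a b e : T * T -> \bar R) :
  measurable_fun setT a -> measurable_fun setT b -> measurable_fun setT e ->
  (forall z, 0 <= a z) -> (forall z, 0 <= b z) -> (forall z, s z -> 0 < e z) ->
  (forall z, s z -> a z + a (z.2, z.1) = b z + b (z.2, z.1) + e z) ->
  \int[P \x P]_z a z < +oo ->
  \int[P \x P]_z a z <= \int[P \x P]_z (if s z then b z else a z) ->
  (P \x P) S = 0.
Proof.
move=> ma mb me a0 b0 e0 abe aoo.
have mS := measurable_swap_gain_set.
have msw : measurable_fun setT (fun z : T * T => (z.2, z.1)).
  exact: measurable_fun_pair.
have split h : measurable_fun setT h -> (forall z, 0 <= h z) ->
    \int[P \x P]_z h z =
    \int[P \x P]_(z in S) h z + \int[P \x P]_(z in ~` S) h z.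
  move=> mh h0; rewrite -(setUv S) ge0_integral_setU//.
  - exact: measurableC.
  - by rewrite setUv.
  - exact/disj_setPCl.
have mc : measurable_fun setT (fun z => if s z then b z else a z).
  exact: measurable_fun_ifT.
have c0 z : 0 <= if s z then b z else a z by case: ifP.
rewrite (split _ mc c0).
have -> : \int[P \x P]_(z in S) (if s z then b z else a z) =
    \int[P \x P]_(z in S) b z.
  by apply: eq_integral => z; rewrite inE /S/= => ->.
have -> : \int[P \x P]_(z in ~` S) (if s z then b z else a z) =
    \int[P \x P]_(z in ~` S) a z.
  by apply: eq_integral => z; rewrite inE /S/= => /negP/negbTE ->.
move: aoo; rewrite (split _ ma a0).
(* [S] and [P \x P] are symmetric, so one copy of each doubled integral can be replaced by its
   swapped version; then the pointwise identity [abe] applies. *)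
have key : \int[P \x P]_(z in S) a z + \int[P \x P]_(z in S) a z =
    \int[P \x P]_(z in S) b z + \int[P \x P]_(z in S) b z +
    \int[P \x P]_(z in S) e z.
  rewrite {2}(integral_swap_set ma a0) {2}(integral_swap_set mb b0).
  have ma' : measurable_fun setT (fun z => a (z.2, z.1)) by exact: measurableT_comp.
  have mb' : measurable_fun setT (fun z => b (z.2, z.1)) by exact: measurableT_comp.
  rewrite -!ge0_integralD//; try exact: measurable_funTS.
  - by apply: eq_integral => z; rewrite inE => /abe.
  - by move=> z _; rewrite adde_ge0.
  - by apply: measurable_funTS; exact: emeasurable_funD.
  - by move=> z /e0/ltW.
have E0 : 0 <= \int[P \x P]_(z in S) e z.
  by apply: integral_ge0 => z /e0/ltW.
have A0 : 0 <= \int[P \x P]_(z in S) a z by exact: integral_ge0.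
have A'0 : 0 <= \int[P \x P]_(z in ~` S) a z by exact: integral_ge0.
move=> aoo ab; apply: (ge0_integral_eq0_set mS me e0).
move: key E0 A0 A'0 aoo ab.
move: (\int[P \x P]_(z in S) a z) (\int[P \x P]_(z in S) b z)
  (\int[P \x P]_(z in S) e z) (\int[P \x P]_(z in ~` S) a z).
(* The total cost is finite, so only real values remain; [2A = 2B + E] together with [A <= B] and
   [E >= 0] forces [E = 0]. *)
move=> [A| |] [B| |] [E| |] [A'| |] //= [key].
rewrite !lee_fin => E0 A0 A'0 _ ab; congr EFin; lra.
Qed.

End swap_gain.

(** * Quadratic cost of couplings *)

Section transport.
Local Open Scope ereal_scope.
Context {R : realType} {d : nat}.
Local Notation V := 'rV[R]_d.
Implicit Types (mu nu : P2 R d) (g : probability (V * V)%type R).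

(** Without the square root of [transport_cost] the cost is affine in the plan, while the minimizers
    are the same. *)
Definition cost2 g : \bar R := \int[g]_p ((enorm (p.1 - p.2)) ^+ 2)%:E.

Lemma measurable_sqdist d' (T : measurableType d') (f h : T -> V) :
  measurable_fun [set: T] f -> measurable_fun [set: T] h ->
  measurable_fun [set: T] (fun t => (enorm (f t - h t) ^+ 2)%:E).
Proof.
move=> mf mh; apply/measurable_EFinP; under eq_fun do rewrite sqr_enorm.
by apply: measurable_dotp; exact: measurable_subV.
Qed.

Lemma cost2_ge0 g : 0 <= cost2 g.
Proof. by apply: integral_ge0 => p _; rewrite lee_fin sqr_ge0. Qed.

Lemma optimal_cost2_le mu nu g g' :
  optimal_coupling mu nu g -> coupling mu nu g' -> cost2 g <= cost2 g'.
Proof.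
move=> [_ gW] cg'; rewrite -lee_sqrt ?cost2_ge0//.
rewrite -[leLHS]/(transport_cost g) gW.
by apply: ereal_inf_lbound; exists g'.
Qed.

Lemma optimal_couplingP mu nu g : coupling mu nu g ->
  (forall g', coupling mu nu g' -> cost2 g <= cost2 g') ->
  optimal_coupling mu nu g.
Proof.
move=> cg gmin; split=> //; apply/eqP; rewrite eq_le; apply/andP; split.
  apply: le_ereal_inf_tmp => _ [g' cg' <-].
  by rewrite lee_sqrt ?cost2_ge0//; exact: gmin.
by apply: ereal_inf_lbound; exists g.
Qed.

Lemma W2_sqr mu nu g : optimal_coupling mu nu g -> W2 mu nu ^+ 2 = cost2 g.
Proof. by move=> [_ <-]; rewrite sqr_sqrte// cost2_ge0. Qed.

Lemma W2_ge0 mu nu : 0 <= W2 mu nu.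
Proof. by apply: le_ereal_inf_tmp => _ [g' _ <-]; exact: sqrte_ge0. Qed.

Lemma W2_sqr_le mu nu g : coupling mu nu g -> W2 mu nu ^+ 2 <= cost2 g.
Proof.
move=> cg; rewrite -(sqr_sqrte (cost2_ge0 g)).
rewrite !expe2; apply: lee_pmul; rewrite ?W2_ge0//;
  by apply: ereal_inf_lbound; exists g.
Qed.

Lemma P2_sqr_fst mu nu g : coupling mu nu g ->
  \int[g]_p (enorm p.1 ^+ 2)%:E < +oo.
Proof.
move=> cg; rewrite -(@ge0_integral_map _ _ _ _ _ g mu fst (fun x => (enorm x ^+ 2)%:E)).
- exact: P2_moment.
- exact: measurable_fst.
- by move=> A mA; have [] := cg A mA.
- apply/measurable_EFinP; under eq_fun do rewrite sqr_enorm.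
  exact: measurable_dotp.
- by move=> y; rewrite lee_fin sqr_ge0.
Qed.

Lemma P2_sqr_snd mu nu g : coupling mu nu g ->
  \int[g]_p (enorm p.2 ^+ 2)%:E < +oo.
Proof.
move=> cg; rewrite -(@ge0_integral_map _ _ _ _ _ g nu snd (fun x => (enorm x ^+ 2)%:E)).
- exact: P2_moment.
- exact: measurable_snd.
- by move=> A mA; have [] := cg A mA.
- apply/measurable_EFinP; under eq_fun do rewrite sqr_enorm.
  exact: measurable_dotp.
- by move=> y; rewrite lee_fin sqr_ge0.
Qed.

(** [|x - y|^2 <= 2|x|^2 + 2|y|^2], and both marginals have finite second moment. *)
Lemma cost2_lty mu nu g : coupling mu nu g -> cost2 g < +oo.
Proof.
move=> cg.
have m1 : measurable_fun [set: V * V] (fun p : V * V => (enorm p.1 ^+ 2)%:E).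
  apply/measurable_EFinP; under eq_fun do rewrite sqr_enorm.
  by apply: measurable_dotp; exact: measurable_fst.
have m2 : measurable_fun [set: V * V] (fun p : V * V => (enorm p.2 ^+ 2)%:E).
  apply/measurable_EFinP; under eq_fun do rewrite sqr_enorm.
  by apply: measurable_dotp; exact: measurable_snd.
apply: (@le_lt_trans _ _ (\int[g]_p (2%:E * (enorm p.1 ^+ 2)%:E + 2%:E * (enorm p.2 ^+ 2)%:E))).
  apply: ge0_le_integral => //.
  - by move=> p _; rewrite lee_fin sqr_ge0.
  - by apply: measurable_sqdist; [exact: measurable_fst|exact: measurable_snd].
  - by apply: emeasurable_funD; exact: measurable_funeM.
  - move=> p _; rewrite -!EFinM -EFinD lee_fin !sqr_enorm.
    have := dotp_ge0 (p.1 + p.2); rewrite !dotpE (dotpC p.2 p.1).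
    set u := dotp p.1 p.1; set v := dotp p.2 p.2; set w := dotp p.1 p.2; lra.
rewrite ge0_integralD//; [|by move=> p _; rewrite -EFinM lee_fin mulr_ge0// sqr_ge0
  |exact: measurable_funeM
  |by move=> p _; rewrite -EFinM lee_fin mulr_ge0// sqr_ge0|exact: measurable_funeM].
rewrite !ge0_integralZl_EFin//; try by move=> p _; rewrite lee_fin sqr_ge0.
by rewrite lte_add_pinfty// lte_mul_pinfty//; [exact: P2_sqr_fst cg|exact: P2_sqr_snd cg].
Qed.

Lemma cost2_fin mu nu g : coupling mu nu g -> cost2 g \is a fin_num.
Proof. by move=> cg; rewrite ge0_fin_numE ?cost2_ge0// (cost2_lty cg). Qed.

End transport.

Section monotone.
Local Open Scope ereal_scope.
Context {R : realType} {d : nat}.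
Local Notation V := 'rV[R]_d.
Local Notation VV := (V * V)%type.
Implicit Types (mu nu : P2 R d) (g : probability (V * V)%type R).

(** The samples [z.1] and [z.2] are crossed when this is negative. *)
Definition pairing (z : VV * VV) : R := dotp (z.1.1 - z.2.1) (z.1.2 - z.2.2).

Let m11 : measurable_fun [set: VV * VV] (fun z : VV * VV => z.1.1).
Proof. exact: (measurableT_comp measurable_fst measurable_fst). Qed.
Let m12 : measurable_fun [set: VV * VV] (fun z : VV * VV => z.1.2).
Proof. exact: (measurableT_comp measurable_snd measurable_fst). Qed.
Let m21 : measurable_fun [set: VV * VV] (fun z : VV * VV => z.2.1).
Proof. exact: (measurableT_comp measurable_fst measurable_snd). Qed.
Let m22 : measurable_fun [set: VV * VV] (fun z : VV * VV => z.2.2).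
Proof. exact: (measurableT_comp measurable_snd measurable_snd). Qed.

Lemma measurable_pairing : measurable_fun [set: VV * VV] pairing.
Proof. by apply: measurable_dotp; exact: measurable_subV. Qed.

Lemma pairing_swap z : pairing (z.2, z.1) = pairing z.
Proof. by rewrite /pairing/= -(opprB z.1.1) -(opprB z.1.2) dotpNl dotpNr opprK. Qed.

Lemma measurable_pairing_lt0 : measurable [set z | (pairing z < 0)%R].
Proof.
have : measurable_fun [set: VV * VV] (fun z => (pairing z < 0)%R).
  by apply: measurable_fun_ltr => //; exact: measurable_pairing.
by move=> /(_ measurableT [set true] I); rewrite setTI.
Qed.

(* The law of [uncross] under [g \x g] is again a coupling, because the set of
   crossed pairs is symmetric. *)
Definition uncross (z : VV * VV) : VV :=
  (z.1.1, if (pairing z < 0)%R then z.2.2 else z.1.2).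

Lemma measurable_uncross : measurable_fun [set: VV * VV] uncross.
Proof.
apply: measurable_fun_pair => //; apply: measurable_fun_ifT => //.
by apply: measurable_fun_ltr => //; exact: measurable_pairing.
Qed.

Lemma coupling_uncross mu nu g (q : probability VV R) : coupling mu nu g ->
  (forall A, q A = pushforward (g \x g) uncross A) -> coupling mu nu q.
Proof.
move=> cg qE A mA; have [gA1 gA2] := cg A mA.
have mB (f : VV -> V) : measurable_fun [set: VV] f -> measurable (f @^-1` A).
  by move=> mf; rewrite -[X in measurable X]setTI; exact: mf.
have gE B : measurable B -> (g \x g) (B `*` [set: VV]) = g B.
  move=> mB'; rewrite product_measure1E// -[RHS]mule1; congr (_ * _).
  exact: probability_setT.
have mS := measurable_pairing_lt0.
set S := [set z | (pairing z < 0)%R] in mS.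
have m1A : measurable (fst @^-1` A : set VV) by exact: (mB _ measurable_fst).
split.
  rewrite -gA1 /pushforward [LHS]qE /pushforward.
  transitivity ((g \x g) ((fst @^-1` A) `*` [set: VV])).
    by congr (_ _); apply/seteqP; split => z //= [].
  exact: gE.
rewrite -gA2 /pushforward [LHS]qE /pushforward.
have m2A : measurable (snd @^-1` A : set VV) by exact: (mB _ measurable_snd).
have mD : measurable ((snd @^-1` A : set VV) `*` [set: VV]).
  exact: measurableX.
have -> : g (snd @^-1` A) = (g \x g) ((snd @^-1` A) `*` [set: VV]).
  by rewrite gE.
set D := (X in _ = _ X) in mD *.
have mD' : measurable ([set: VV] `*` (snd @^-1` A : set VV)).
  exact: measurableX.
set D' := (X in measurable X) in mD'.
have mDS : measurable (D `&` S) by exact: measurableI.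
have mDnS : measurable (D `\` S) by exact: measurableD.
have mD'S : measurable (D' `&` S) by exact: measurableI.
(* Exchanging the samples preserves [g \x g] and [S] and turns [D], a condition on the second
   coordinate of the first sample, into the same condition [D'] on the second sample. On [S] this is
   the coordinate that [uncross] selects. *)
have swapDS : (g \x g) (D `&` S) = (g \x g) (D' `&` S).
  rewrite (product_measure_swap g mDS); congr ((g \x g) _).
  by apply/seteqP; split => z; rewrite /D /D' /S/= pairing_swap; tauto.
have e1 : (g \x g) D = (g \x g) (D `&` S) + (g \x g) (D `\` S).
  rewrite -measureU//; last by apply/seteqP; split => z //= [[_ ?] []].
  by congr (_ _); rewrite setUIDK.
have e2 : (g \x g) ((D' `&` S) `|` (D `\` S)) =
    (g \x g) (D' `&` S) + (g \x g) (D `\` S).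
  by rewrite measureU//; apply/seteqP; split => z //= [[_ ?] []].
rewrite e1 swapDS -e2.
congr ((g \x g) _); apply/seteqP; split => z; rewrite /D /D' /S /uncross/=.
  by case: ifP => zS ?; [left|right; split=> //; rewrite zS].
by case: ifP => zS [[[_ ?] ?]|[[? _] ?]].
Qed.

Let sqd (x y : V) : \bar R := (enorm (x - y) ^+ 2)%:E.

Lemma optimal_monotone mu nu g : optimal_coupling mu nu g ->
  (g \x g) [set z | (pairing z < 0)%R] = 0.
Proof.
move=> og; have [cg _] := og.
have [q qE] := exists_pushforward (g \x g) measurable_uncross.
have cq := coupling_uncross cg qE.
have sqd0 x y : 0 <= sqd x y by rewrite lee_fin sqr_ge0.
have m12' : measurable_fun [set: VV] (fun p : VV => sqd p.1 p.2).
  by apply: measurable_sqdist; [exact: measurable_fst|exact: measurable_snd].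
pose a (z : VV * VV) := sqd z.1.1 z.1.2.
pose b (z : VV * VV) := sqd z.1.1 z.2.2.
pose e (z : VV * VV) : \bar R := (- 2 * pairing z)%:E.
have ma : measurable_fun setT a by exact: measurable_sqdist.
have mb : measurable_fun setT b by exact: measurable_sqdist.
have me : measurable_fun setT e.
  apply/measurable_EFinP; apply: measurable_funM => //.
  exact: measurable_pairing.
have ga : cost2 g = \int[g \x g]_z a z.
  by symmetry; exact: (@ge0_integral_prod_fst _ _ _ _ _ g g (fun p => sqd p.1 p.2)).
have gb : cost2 q =
    \int[g \x g]_z (if (pairing z < 0)%R then b z else a z).
  transitivity (\int[g \x g]_z sqd (uncross z).1 (uncross z).2).
    apply: (@ge0_integral_map _ _ _ _ _ _ _ _ (fun p => sqd p.1 p.2)) => //.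
    - exact: measurable_uncross.
    - by move=> A _; exact: qE.
  by apply: eq_integral => z _; rewrite /uncross/=; case: ifP.
have ms : measurable_fun [set: VV * VV] (fun z => (pairing z < 0)%R).
  by apply: measurable_fun_ltr => //; exact: measurable_pairing.
apply: (swap_gain_null ms _ ma mb me) => [z|z|z|z|z||].
- by rewrite pairing_swap.
- exact: sqd0.
- exact: sqd0.
- by rewrite lte_fin mulNr => ?; rewrite oppr_gt0 pmulr_rlt0.
- move=> _; rewrite /a /b /e /sqd -!EFinD; congr EFin.
  by rewrite !sqr_enorm dotp_exchange.
- by rewrite -ga; exact: cost2_lty cg.
- by rewrite -ga -gb; exact: optimal_cost2_le og cq.
Qed.

End monotone.

(** * Multivalued points of a monotone set *)

Lemma null_bigcup_countType d0 (T : measurableType d0) (R : realType)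
    (m : {measure set T -> \bar R}) (I : countType) (F : I -> set T) :
  (forall i, measurable (F i)) -> (forall i, m (F i) = 0%E) ->
  m (\bigcup_i F i) = 0%E.
Proof.
move=> mF F0; pose G n := if unpickle n is Some i then F i else set0.
have -> : \bigcup_i F i = \bigcup_n G n.
  apply/seteqP; split => [x [i _ Fx]|x [n _]].
    by exists (pickle i) => //; rewrite /G pickleK.
  by rewrite /G; case: unpickle => // i Fx; exists i.
have mG n : measurable (G n) by rewrite /G; case: unpickle.
have mUG : measurable (\bigcup_n G n) by exact: bigcup_measurable.
apply/(negligibleP m mUG).
apply: negligible_bigcup => n; apply/(negligibleP m (mG n)).
by rewrite /G; case: unpickle => //; rewrite measure0.
Qed.

(** * Support of a plan *)

Section support.
Context {R : realType} {d : nat}.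
Local Notation V := 'rV[R]_d.
Local Notation VV := (V * V)%type.
Local Notation index := ('rV[rat]_d * nat)%type.
Implicit Types (g : probability (V * V)%type R).

(** Testing only rational rectangles gives the topological support and makes its complement a
    countable union of null rectangles, hence null. *)
Definition supp g : set VV := [set p | forall q1 q2 : index,
  rball q1 p.1 -> rball q2 p.2 -> g (rball q1 `*` rball q2) != 0%E].

Lemma setC_supp g : ~` supp g = \bigcup_(q in
  [set q : index * index | g (rball q.1 `*` rball q.2) = 0%E])
    (rball q.1 `*` rball q.2).
Proof.
apply/seteqP; split => p.
  move=> /existsNP[q1] /existsNP[q2] /not_implyP[p1] /not_implyP[p2].
  by move=> /negP/negPn/eqP gq; exists (q1, q2).
by move=> [[q1 q2] /= gq [/= p1 p2]] /(_ q1 q2 p1 p2); rewrite gq eqxx.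
Qed.

Lemma closed_supp g : closed (supp g).
Proof.
rewrite -openC setC_supp; apply: bigcup_open => q _.
rewrite openE => p [p1 p2]; exists (rball q.1, rball q.2) => //.
by split; apply: open_nbhs_nbhs; split=> //; exact: ball_open.
Qed.

Let mrect (q : index * index) :
  measurable (rball q.1 `*` rball q.2 : set VV).
Proof. by apply: measurableX; exact: measurable_rball. Qed.

Lemma setC_supp_measurable_null g :
  measurable (~` supp g) /\ g (~` supp g) = 0%E.
Proof.
rewrite setC_supp bigcup_mkcond; split.
  apply: countable_bigcupT_measurable; first exact: countableP.
  by move=> q; case: ifP => // _; exact: mrect.
apply: null_bigcup_countType => q.
  by case: ifP => // _; exact: mrect.
by case: ifP => [|_]; [rewrite inE|rewrite measure0].
Qed.

Lemma pairing_continuous : continuous (@pairing R d).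
Proof.
rewrite /pairing /dotp; apply: continuous_big; first exact: add_continuous.
move=> i _ z; rewrite /continuous_at.
under eq_cvg do rewrite !mxE; rewrite !mxE.
have c (f : VV * VV -> V) : {for z, continuous f} ->
    (fun z => f z ord0 i) z @[z --> z] --> f z ord0 i.
  move=> cf; exact: (@cvg_comp _ _ _ f (fun M : V => M ord0 i) _ _ _ cf
    (@coord_continuous R 1 d ord0 i (f z))).
apply: cvgM; apply: cvgB; apply: c; apply: cvg_comp.
- exact: cvg_fst.
- exact: cvg_fst.
- exact: cvg_snd.
- exact: cvg_fst.
- exact: cvg_fst.
- exact: cvg_snd.
- exact: cvg_snd.
- exact: cvg_snd.
Qed.

(** If two support points were crossed, by continuity so would be all points of two small rectangles
    around them; each rectangle has positive mass, so their product would too. *)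
Lemma supp_pairing_ge0 g : (g \x g)%E [set z | pairing z < 0] = 0%E ->
  forall p p', supp g p -> supp g p' -> 0 <= pairing (p, p').
Proof.
move=> g0 p p' sp sp'; rewrite leNgt; apply/negP => pp'.
have : nbhs (p, p') [set z | pairing z < 0].
  apply: open_nbhs_nbhs; split=> //.
  apply: (@open_comp _ _ (@pairing R d) [set r : R | r < 0]).
    by move=> z _; exact: pairing_continuous.
  exact: open_lt.
move=> /nbhs_ballP[e /= e0 eS].
have [q1 pq1 q1e] := rball_basis p.1 e0.
have [q2 pq2 q2e] := rball_basis p.2 e0.
have [q1' pq1' q1e'] := rball_basis p'.1 e0.
have [q2' pq2' q2e'] := rball_basis p'.2 e0.
have : ((g \x g) ((rball q1 `*` rball q2) `*` (rball q1' `*` rball q2')) = 0)%E.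
  apply/eqP; rewrite eq_le measure_ge0 andbT -g0 le_measure ?inE//.
  - by apply: measurableX; exact: (mrect (_, _)).
  - exact: measurable_pairing_lt0.
  - move=> [[x y] [x' y']] /= [[? ?] [? ?]]; apply: eS; split; split => /=.
    + exact: q1e.
    + exact: q2e.
    + exact: q1e'.
    + exact: q2e'.
rewrite product_measure1E; [|exact: (mrect (_, _))|exact: (mrect (_, _))].
apply/eqP; rewrite mule_neq0//; [exact: sp|exact: sp'].
Qed.

(** A tube lemma: compactness of [K] gives one neighborhood of [x] that works for all [y] in [K]. It
    makes projections of pieces of the support Borel. *)
Lemma closed_projection (C : set VV) (K : set V) : closed C -> compact K ->
  closed [set x | exists2 y, K y & C (x, y)].
Proof.
move=> cC /compact_near_coveringP cK; rewrite -openC openE => x /= Kx.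
suff : \forall x' \near x, K `<=` (fun y => ~ C (x', y)).
  by apply: filterS => x' Kx' [y Ky]; exact: Kx'.
apply: (cK _ (nbhs x) (fun x' y => ~ C (x', y))) => y Ky.
have Cxy : ~ C (x, y) by move=> ?; apply: Kx; exists y.
have : nbhs (x, y) (~` C) by apply: open_nbhs_nbhs; split=> //; exact: closed_openC.
by case=> -[A B] /= [Ax By] AB; exists (B, A) => // -[u v] [/= ? ?]; exact: (AB (v, u)).
Qed.

End support.

Lemma nneseries_ltn (R : realType) (f : nat -> \bar R) (n : nat) :
  (forall k, 0 <= f k)%E ->
  (\sum_(0 <= k <oo | (k < n)%N) f k = \sum_(0 <= k < n) f k)%E.
Proof.
move=> f0; rewrite eseries_mkcond (nneseries_split 0 n); last first.
  by move=> k _; case: ifP.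
rewrite [X in (_ + X)%E]eseries0 ?adde0 ?add0n; last first.
  by move=> k nk _; rewrite ltnNge nk.
by apply: eq_big_nat => k /andP[_ kn]; rewrite kn.
Qed.

(** * Lipschitz graphs are Lebesgue-null *)

Section lipschitz_graph.
Context {R : realType} {d : nat}.
Local Notation V := 'rV[R]_d.

Lemma box_volume_ge0 (a b : V) : 0 <= box_volume a b.
Proof. by apply: prodr_ge0 => i _; rewrite le_max lexx. Qed.

Lemma lebesgue_rV_ge0 (A : set V) : (0 <= lebesgue_rV A)%E.
Proof.
apply: le_ereal_inf_tmp => _ [K [a [b [_ ->]]]].
by apply: nneseries_ge0 => k _ _; rewrite lee_fin box_volume_ge0.
Qed.

Lemma lebesgue_rV_fin_cover (T : finType) (c0 : T) (a b : T -> V) (A : set V) :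
  (forall x, A x -> exists c, box (a c) (b c) x) ->
  (lebesgue_rV A <= (\sum_c box_volume (a c) (b c))%:E)%E.
Proof.
move=> cover; apply: ereal_inf_lbound.
exists (fun n => (n < #|T|)%N), (a \o nth c0 (enum T)), (b \o nth c0 (enum T)).
split.
  move=> x /cover[c xc]; exists (enum_rank c) => /=; first exact: ltn_ord.
  by rewrite nth_enum_rank.
rewrite nneseries_ltn; last by move=> k; rewrite lee_fin box_volume_ge0.
rewrite sumEFin; congr EFin.
by rewrite -big_enum (big_nth c0) cardE.
Qed.

(** Take the least [m] with [x <= - M + m * h]; it is positive since [- M < x], and [j] is its
    predecessor. *)
Lemma grid_cell (M x : R) (n : nat) : - M < x < M ->
  exists j : 'I_n.+1, let h := 2 * M / n.+1%:R in
    - M + j%:R * h < x <= - M + j.+1%:R * h.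
Proof.
move=> /andP[Mx xM]; set h := 2 * M / n.+1%:R.
have Nh : n.+1%:R * h = 2 * M by rewrite mulrC divfK.
have exm : exists m, x <= - M + m%:R * h.
  by exists n.+1; rewrite Nh; lra.
case: (ex_minnP exm) => -[|m] xm minm; first by move: xm; rewrite mul0r; lra.
have mn : (m < n.+1)%N by apply: minm; rewrite Nh; lra.
exists (Ordinal mn) => /=; rewrite xm andbT ltNge; apply/negP => /minm.
by rewrite ltnn.
Qed.

(** The hypothesis says that coordinate [k] is a [C]-Lipschitz function of the others for the sup
    norm. Over each cell of side [2M/(n+1)] of a grid in the other coordinates, one box of height
    proportional to that side covers the graph, so the total volume is of order [1/(n+1)]. *)
Lemma lipschitz_graph_null (A : set V) (k : 'I_d) (M C : R) :
  0 < M -> 0 <= C -> (forall x, A x -> forall i, - M < x ord0 i < M) ->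
  (forall x x', A x -> A x' -> forall h,
    (forall i, i != k -> `|x ord0 i - x' ord0 i| <= h) ->
    `|x ord0 k - x' ord0 k| <= C * h) ->
  lebesgue_rV A = 0%E.
Proof.
move=> M0 C0 AM AC; apply/eqP; rewrite eq_le lebesgue_rV_ge0 andbT.
(* With [h = 2M/(n+1)], the boxes have height [2(C+1)h] and their bases fill a cube of side [2M] in
   the other coordinates, so [L/(n+1)] is their total volume. *)
pose L := 2 * (C + 1) * \prod_(i < d | i != k) (2 * M) * (2 * M).
suff H n : (lebesgue_rV A <= (L / n.+1%:R)%:E)%E.
  apply/lee_addgt0Pr => e e0; rewrite add0e.
  have L0 : 0 < L.
    rewrite !mulr_gt0//; first by rewrite ltr_wpDl.
    by apply: prodr_gt0 => i _; rewrite mulr_gt0.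
  have [n _ /(_ _ (leqnn n)) /= ne] := near_infty_natSinv_lt (PosNum (divr_gt0 e0 L0)).
  apply: le_trans (H n) _; rewrite lee_fin.
  by rewrite mulrC -ler_pdivlMr// ltW.
pose h := 2 * M / n.+1%:R.
have h0 : 0 < h by rewrite divr_gt0// mulr_gt0.
pose cells := {ffun 'I_d -> 'I_n.+1}.
pose cell (c : cells) : set V := [set x | A x /\
  forall i, i != k -> - M + (c i)%:R * h < x ord0 i <= - M + (c i).+1%:R * h].
(* A reference point of [A] over the cell; over an empty cell the default 0 only adds a box that
   still counts in the volume. *)
pose x0 c := xget 0 (cell c).
(* Boxes are open on their lower faces: the margin [C + 1] in place of [C] makes the lower
   inequality in direction [k] strict. *)
pose a (c : cells) : V := \row_i
  if i == k then x0 c ord0 k - (C + 1) * h else - M + (c i)%:R * h.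
(* A zero width when [c k != 0] keeps one box per cell of the hyperplane, and
   makes the total volume a product of sums over the coordinates. *)
pose w (i : 'I_d) (j : 'I_n.+1) : R :=
  if i == k then (if j == ord0 then 2 * (C + 1) * h else 0) else h.
have w0 i j : 0 <= w i j.
  rewrite /w; case: ifP => _; last exact: ltW.
  by case: ifP => // _; rewrite !mulr_ge0// ?addr_ge0// ltW.
pose b (c : cells) : V := a c + \row_i w i (c i).
have vol c : box_volume (a c) (b c) = \prod_i w i (c i).
  by apply: eq_bigr => i _; rewrite /b !mxE addrAC subrr add0r max_r.
have -> : L / n.+1%:R = \sum_c box_volume (a c) (b c).
  under eq_bigr do rewrite vol.
  rewrite -(bigA_distr_bigA w) (bigD1 k)//=.
  rewrite /w eqxx -big_mkcond big_pred1_eq.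
  under eq_bigr => i /negbTE ik do rewrite ik sumr_const card_ord -mulr_natl mulrC divfK//.
  by rewrite /L /h; ring.
apply: (lebesgue_rV_fin_cover [ffun=> ord0]) => x Ax.
have /choice[j jP] : forall i, exists j : 'I_n.+1,
    - M + j%:R * h < x ord0 i <= - M + j.+1%:R * h.
  by move=> i; apply: grid_cell; exact: AM.
(* [ord0] is the only index in direction [k] whose box has nonzero width. *)
pose c : cells := [ffun i => if i == k then ord0 else j i].
have xc : cell c x.
  by split=> // i ik; rewrite ffunE (negbTE ik); exact: jP.
have x0c : cell c (x0 c) by exact: (xgetPex 0 (ex_intro _ x xc)).
exists c => i; rewrite /b !mxE /w.
have [->|ik] := eqVneq i k; last first.
  by have := xc.2 _ ik; rewrite -natr1; lra.
rewrite /c ffunE !eqxx/=.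
have : `|x ord0 k - x0 c ord0 k| <= C * h.
  apply: AC => //; first exact: x0c.1.
  move=> i' ik'; have := xc.2 _ ik'; have := x0c.2 _ ik'.
  rewrite -natr1 ler_norml; lra.
rewrite ler_norml; lra.
Qed.

End lipschitz_graph.

(** * Points with two separated images *)

Section graph.
Context {R : realType} {d : nat}.
Local Notation V := 'rV[R]_d.
Local Notation VV := (V * V)%type.
Local Notation index := ('rV[rat]_d * nat)%type.
Implicit Types (mu nu : P2 R d) (g : probability (V * V)%type R) (q : index).

Definition center q : V := map_mx ratr q.1.
Definition radius q : R := q.2.+1%:R^-1.

(** Closed balls are used besides [rball] because [closed_projection] needs compact sets. *)
Definition cball q : set V :=
  [set y | forall i, `|y ord0 i - center q ord0 i| <= radius q].

Lemma radius_ge0 q : 0 <= radius q.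
Proof. by rewrite invr_ge0. Qed.

Lemma rball_cball q : rball q `<=` cball q.
Proof.
move=> y [_ /= yq] i; have := yq ord0 i.
by rewrite /ball/= distrC => /ltW.
Qed.

Lemma cball_basis (x : V) (e : R) : 0 < e ->
  exists q, [/\ cball q x, radius q < e & cball q `<=` ball x e].
Proof.
move=> e0; have e20 : 0 < e / 2 by rewrite divr_gt0.
have [q /rball_cball qx qe] := exists_rball x e20.
exists q; split => //; first by apply: lt_trans qe _; lra.
move=> y qy; split => //= i j; rewrite !ord1 /ball/=.
have := ler_normB (x ord0 j - center q ord0 j) (y ord0 j - center q ord0 j).
rewrite opprB addrA subrK; have := qx j; have := qy j; move: qe.
rewrite -/(radius q); lra.
Qed.

Lemma compact_cball q : compact (cball q).
Proof.
have -> : cball q = [set y : V | forall i,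
    `[center q ord0 i - radius q, center q ord0 i + radius q]%classic (y ord0 i)].
  apply/seteqP; split => y /= yq i; have := yq i;
  by rewrite /= in_itv/= ler_distl.
apply: (@rV_compact _ _ (fun i =>
  `[center q ord0 i - radius q, center q ord0 i + radius q]%classic)) => i.
exact: segment_compact.
Qed.

Lemma open_bigcup_cball (A : set V) : open A ->
  A = \bigcup_(q in [set q | cball q `<=` A]) cball q.
Proof.
move=> oA; apply/seteqP; split => [x Ax|x [q qA qx]]; last exact: qA.
have /nbhs_ballP[e /= e0 eA] : nbhs x A by exact: open_nbhs_nbhs.
have [q [qx _ qe]] := cball_basis x e0.
by exists q => //=; exact: subset_trans eA.
Qed.

(** The preimage of a ball under the support, read as a multivalued map. *)
Definition shadow g q : set V := [set x | exists2 y, cball q y & supp g (x, y)].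

Lemma measurable_shadow g q : measurable (shadow g q).
Proof.
apply: closed_measurable_rV; apply: closed_projection.
  exact: closed_supp.
exact: compact_cball.
Qed.

(** Isolate [v_k * w_k] in the inner product. The share [rho * |v_k|] of the bound is absorbed on
    the left, where [|w_k| - rho] is positive; the other coordinates are at most [h]. *)
Lemma cone_bound (v w : V) (k : 'I_d) (rho h : R) : rho < `|w ord0 k| ->
  `|dotp v w| <= rho * \sum_i `|v ord0 i| ->
  (forall i, i != k -> `|v ord0 i| <= h) -> 0 <= rho ->
  `|v ord0 k| <=
    (\sum_(i | i != k) (rho + `|w ord0 i|)) / (`|w ord0 k| - rho) * h.
Proof.
move=> rw vw vh rho0.
have vkw : v ord0 k * w ord0 k =
    dotp v w - \sum_(i | i != k) v ord0 i * w ord0 i.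
  by rewrite /dotp (bigD1 k)//= addrK.
rewrite mulrAC ler_pdivlMr ?subr_gt0// mulrBr -normrM vkw lerBlDr.
apply: (@le_trans _ _ (rho * (\sum_i `|v ord0 i|) +
    \sum_(i | i != k) `|v ord0 i * w ord0 i|)).
  by apply: (le_trans (ler_normB _ _)); apply: lerD => //; exact: ler_norm_sum.
rewrite (bigD1 k)//= mulrDr -addrA (mulrC rho `|v ord0 k|) [leRHS]addrC lerD2l.
rewrite mulr_sumr -big_split/= mulr_suml; apply: ler_sum => i ik.
rewrite normrM (mulrC `|v ord0 i| `|w ord0 i|) -mulrDl.
by apply: ler_wpM2l; [rewrite addr_ge0|exact: vh].
Qed.

(** The gap in one coordinate exceeds the sum of the radii, which is the strict hypothesis of
    [cone_bound] for [w] the difference of the centers. *)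
Definition separated (qq : index * index) : bool :=
  [exists k, radius qq.1 + radius qq.2 <
    `|center qq.1 ord0 k - center qq.2 ord0 k|].

(* The two monotonicity inequalities bound the component of [x - x'] along the
   difference of the centers, hence put the intersection of two shadows on a
   Lipschitz graph. *)
Lemma shadow_cone mu nu g q q' (x x' : V) : optimal_coupling mu nu g ->
  (shadow g q `&` shadow g q') x -> (shadow g q `&` shadow g q') x' ->
  `|dotp (x - x') (center q - center q')| <=
    (radius q + radius q') * \sum_i `|(x - x') ord0 i|.
Proof.
move=> og.
have mono := supp_pairing_ge0 (optimal_monotone og).
have aux a a' b b' : shadow g a b -> shadow g a' b' ->
    dotp (b - b') (center a' - center a) <=
    (radius a + radius a') * \sum_i `|(b - b') ord0 i|.
  move=> [y ay sy] [y' ay' sy']; have := mono _ _ sy sy'.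
  rewrite /pairing/= => h.
  (* Monotonicity allows adding [y - y']; each coordinate of the sum is then bounded by the two
     radii. *)
  apply: (@le_trans _ _ (dotp (b - b') ((center a' - center a) + (y - y')))).
    by rewrite [leRHS]dotpDr lerDl.
  rewrite mulr_sumr; apply: ler_sum => i _.
  apply: (le_trans (ler_norm _)); rewrite normrM mulrC ler_wpM2r//.
  rewrite !mxE.
  rewrite [X in `|X|](_ : _ = (y ord0 i - center a ord0 i) - (y' ord0 i - center a' ord0 i)).
    by apply: (le_trans (ler_normB _ _)); apply: lerD; [exact: ay|exact: ay'].
  by rewrite /center !mxE; ring.
(* Each point has an image in both balls, so the balls can be assigned to the points in either
   order, which gives the two signs. *)
move=> [xq xq'] [x'q x'q']; rewrite ler_norml; apply/andP; split; last first.
  by have := aux q' q x x' xq' x'q; rewrite (addrC (radius q')).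
by have := aux q q' x x' xq x'q'; rewrite -(opprB (center q')) dotpNr lerNl opprK.
Qed.

Lemma shadow_null mu nu g (qq : index * index) : absolutely_continuous mu ->
  optimal_coupling mu nu g -> separated qq ->
  mu (shadow g qq.1 `&` shadow g qq.2) = 0%E.
Proof.
case: qq => q q' ac og /existsP[k /= sep].
set A := _ `&` _.
have mA : measurable A by apply: measurableI; exact: measurable_shadow.
(* Bounded windows, as [lipschitz_graph_null] requires a bounded set. *)
pose B (n : nat) := A `&` \bigcap_(i : 'I_d) [set x : V | - n.+1%:R < x ord0 i < n.+1%:R].
have mB n : measurable (B n).
  apply: measurableI => //; apply: fin_bigcap_measurable => // i _.
  rewrite [X in measurable X](_ : _ = (fun x : V => x ord0 i) @^-1` `]- n.+1%:R, n.+1%:R[%classic).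
    by rewrite -[X in measurable X]setTI; apply: measurable_coord => //.
  by apply/seteqP; split => x/=; rewrite in_itv.
have AB : A = \bigcup_n B n.
  apply/seteqP; split => [x Ax|x [n _ []]//].
  have [n nx] : exists n : nat, `|x| < n.+1%:R.
    by exists (Num.truncn `|x|); rewrite truncnS_gt.
  exists n => //; split=> // i _ /=.
  rewrite -ltr_norml; apply: le_lt_trans nx.
  by rewrite [leRHS]/Num.Def.normr /= mx_normrE; apply/bigmax_geP; right; exists (ord0, i).
rewrite AB; apply: null_bigcup_countType => // n.
(* Domination asks for every measurable subset [D] of [B n] to be Lebesgue-null; [D] inherits the
   graph bound. *)
apply: (ac (B n) _ (B n)) => // D _ DB.
apply: (@lipschitz_graph_null _ _ _ k n.+1%:R ((\sum_(i | i != k)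
    ((radius q + radius q') + `|(center q - center q') ord0 i|)) /
    (`|(center q - center q') ord0 k| - (radius q + radius q')))) => //.
- rewrite divr_ge0//.
    by apply: sumr_ge0 => i _; rewrite !addr_ge0// radius_ge0.
  by rewrite !mxE subr_ge0; move: sep; rewrite !mxE => /ltW.
- by move=> x /DB[_ Bx] i; exact: Bx.
move=> x x' /DB[Ax _] /DB[Ax' _] h hi.
have -> : x ord0 k - x' ord0 k = (x - x') ord0 k by rewrite !mxE.
apply: cone_bound.
- by move: sep; rewrite !mxE.
- exact: shadow_cone og Ax Ax'.
- by move=> i ik; rewrite !mxE; exact: hi.
- by rewrite addr_ge0// radius_ge0.
Qed.

(** Two distinct images lie in separated balls of the countable family, so this countable union
    contains every point with more than one image. *)
Definition multivalued g : set V :=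
  \bigcup_(qq in [set qq | separated qq]) (shadow g qq.1 `&` shadow g qq.2).

Lemma measurable_multivalued g : measurable (multivalued g).
Proof.
rewrite /multivalued bigcup_mkcond.
apply: countable_bigcupT_measurable; first exact: countableP.
move=> q; case: ifP => // _.
by apply: measurableI; exact: measurable_shadow.
Qed.

Lemma multivalued_null mu nu g : absolutely_continuous mu ->
  optimal_coupling mu nu g -> mu (multivalued g) = 0%E.
Proof.
move=> ac og; rewrite /multivalued bigcup_mkcond.
apply: null_bigcup_countType => qq.
  case: ifP => // _.
  by apply: measurableI; exact: measurable_shadow.
case: ifP => [|_]; rewrite ?measure0// inE.
exact: shadow_null ac og.
Qed.

Lemma supp_functional g (x y y' : V) : ~ multivalued g x ->
  supp g (x, y) -> supp g (x, y') -> y = y'.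
Proof.
move=> nx sy sy'; apply: contrapT => yy'; apply: nx.
have [k yk] : exists k, y ord0 k != y' ord0 k.
  apply: contrapT => /forallNP h; apply: yy'; apply/rowP => k.
  by have /negP := h k; rewrite negbK => /eqP.
(* With radii below a quarter of the gap, the centers stay more than half the gap apart, which
   exceeds the sum of the radii. *)
have e0 : 0 < `|y ord0 k - y' ord0 k| / 4.
  by rewrite divr_gt0// normr_gt0 subr_eq0.
have [q [yq rq _]] := cball_basis y e0.
have [q' [yq' rq' _]] := cball_basis y' e0.
exists (q, q'); last by split; [exists y|exists y'].
apply/existsP; exists k => /=.
have := yq k; have := yq' k; move: rq rq'.
have := ler_normB (y ord0 k - center q ord0 k) (y' ord0 k - center q' ord0 k).
have := ler_normD (y ord0 k - center q ord0 k - (y' ord0 k - center q' ord0 k))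
  (center q ord0 k - center q' ord0 k).
rewrite [X in `|X| <= _ + _](_ : _ = y ord0 k - y' ord0 k); last by ring.
lra.
Qed.

End graph.

(** * Optimal maps *)

Section brenier.
Context {R : realType} {d : nat}.
Local Notation V := 'rV[R]_d.
Local Notation VV := (V * V)%type.
Local Notation index := ('rV[rat]_d * nat)%type.
Implicit Types (mu nu : P2 R d) (g : probability (V * V)%type R) (q : index).

(** [f] is selected by choice; it is Borel because its preimages of compact balls are given by
    shadows. *)
Lemma supp_graph g : exists2 f : V -> V, measurable_fun [set: V] f &
  forall x y, ~ multivalued g x -> supp g (x, y) -> y = f x.
Proof.
pose D := ~` multivalued g `&` \bigcup_q shadow g q.
have mD : measurable D.
  apply: measurableI; first by apply: measurableC; exact: measurable_multivalued.
  apply: countable_bigcupT_measurable; first exact: countableP.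
  by move=> q; exact: measurable_shadow.
have inD x y : ~ multivalued g x -> supp g (x, y) -> D x.
  move=> nx sy; split => //; have [q [qy _ _]] := cball_basis y ltr01.
  by exists q => //; exists y.
pose f x : V := if x \in D then xget 0 [set y | supp g (x, y)] else 0.
have suppf x : D x -> supp g (x, f x).
  move=> Dx; rewrite /f mem_set//; have [_ [q _ [y _ sy]]] := Dx.
  exact: (xgetPex 0 (ex_intro (fun y => supp g (x, y)) y sy)).
exists f; last first.
  move=> x y nx sy; have /suppf sf := inD _ _ nx sy.
  exact: supp_functional sy sf.
apply: (@measurability _ _ _ _ _ _ (@open V)) => //.
move=> _ [A oA <-]; rewrite setTI (open_bigcup_cball oA) preimage_bigcup.
rewrite bigcup_mkcond; apply: countable_bigcupT_measurable.
  exact: countableP.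
move=> q; case: ifP => // _.
have -> : f @^-1` cball q =
    (D `&` shadow g q) `|` (if `[< cball q (0 : V) >] then ~` D else set0).
  apply/seteqP; split => x /=.
    move=> fx; have [Dx|Dx] := pselect (D x).
      by left; split => //; exists (f x) => //; exact: suppf.
    by right; move: fx; rewrite /f memNset// => /asboolT ->.
  move=> [[Dx [y qy sy]]|]; last first.
    by case: asboolP => // q0 Dx; rewrite /f memNset.
  by rewrite -(supp_functional Dx.1 sy (suppf _ Dx)).
apply: measurableU; first by apply: measurableI => //; exact: measurable_shadow.
by case: ifP => // _; exact: measurableC.
Qed.

(** Outside the [g']-null set [N], points lie on the graph of [f], so there [A] coincides with the
    cylinder over [B], whose mass the first marginal gives. The plan [g'] may differ from the plan
    [g] whose support is used. *)
Lemma concentrated_graph mu nu g g' (f : V -> V) : coupling mu nu g' ->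
  measurable_fun [set: V] f ->
  mu (multivalued g) = 0%E -> g' (~` supp g) = 0%E ->
  (forall x y, ~ multivalued g x -> supp g (x, y) -> y = f x) ->
  forall A : set VV, measurable A ->
    g' A = pushforward mu (fun x => (x, f x)) A.
Proof.
move=> cg' mf mu0 g'0 fE A mA.
have mN := measurable_multivalued g.
have [mS _] := setC_supp_measurable_null g.
have mxf : measurable_fun [set: V] (fun x => (x, f x)).
  by apply: measurable_fun_pair.
pose N : set VV := ~` supp g `|` fst @^-1` multivalued g.
have mN1 : measurable (fst @^-1` multivalued g : set VV).
  by rewrite -[X in measurable X]setTI; exact: measurable_fst.
have mNN : measurable N by exact: measurableU.
have N0 : g' N = 0%E.
  apply/eqP; rewrite eq_le measure_ge0 andbT.
  apply: (@le_trans _ _ (g' (~` supp g) + g' (fst @^-1` multivalued g))%E).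
    exact: measureU2.
  have [gN _] := cg' _ mN.
  by rewrite g'0 add0e; move: gN; rewrite /pushforward mu0 => ->.
pose B : set V := [set x | A (x, f x)].
have mB : measurable B by rewrite -[X in measurable X]setTI; exact: mxf.
have mB1 : measurable (fst @^-1` B : set VV).
  by rewrite -[X in measurable X]setTI; exact: measurable_fst.
have [gB _] := cg' _ mB; rewrite /pushforward -/B -gB /pushforward.
have key (E E' : set VV) : measurable E -> measurable E' ->
    E `<=` E' `|` N -> (g' E <= g' E')%E.
  move=> mE mE' EE'.
  apply: (@le_trans _ _ (g' (E' `|` N))).
    by apply: le_measure; rewrite ?inE//; exact: measurableU.
  apply: (@le_trans _ _ (g' E' + g' N)%E); first exact: measureU2.
  by rewrite N0 adde0.
apply/eqP; rewrite eq_le; apply/andP; split; apply: key => // -[x y] /= Axy.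
  have [Nxy|/not_orP[/contrapT sxy nx]] := pselect (N (x, y)); [by right|left].
  by rewrite /B/= -(fE _ _ nx sxy).
have [Nxy|/not_orP[/contrapT sxy nx]] := pselect (N (x, y)); [by right|left].
by rewrite (fE _ _ nx sxy).
Qed.

Lemma optimal_midpoint mu nu g1 g2 (m : probability VV R) :
  optimal_coupling mu nu g1 -> optimal_coupling mu nu g2 ->
  (forall A, m A = (2^-1)%:E * (g1 A + g2 A))%E ->
  cost2 m = ((2^-1)%:E * (cost2 g1 + cost2 g2))%E ->
  optimal_coupling mu nu m.
Proof.
move=> o1 o2 mE cm; have [c1 _] := o1; have [c2 _] := o2.
have half (a : \bar R) : ((2^-1)%:E * (a + a) = a)%E.
  rewrite -mule2n -[X in (_ * X)%E]mule_natl muleA -EFinM mulVf ?mul1e//.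
apply: optimal_couplingP.
  move=> A mA; have [a1 b1] := c1 A mA; have [a2 b2] := c2 A mA.
  rewrite /pushforward in a1 b1 a2 b2 *.
  by rewrite !mE [X in (X + _)%E]a1 [X in (_ + X)%E]a2 b1 b2 !half.
move=> g' cg'; rewrite cm -[leRHS]half lee_wpmul2l ?lee_fin ?invr_ge0//.
by apply: leeD; [exact: optimal_cost2_le o1 cg'|exact: optimal_cost2_le o2 cg'].
Qed.

(** The midpoint of the two plans is optimal, so its support is a graph up to a null set; both plans
    vanish off this support, hence sit on the same graph. Taking [g1 = g2] gives existence of the
    map. *)
Lemma optimal_map_unique mu nu g1 g2 : absolutely_continuous mu ->
  optimal_coupling mu nu g1 -> optimal_coupling mu nu g2 ->
  exists2 f : V -> V, measurable_fun [set: V] f &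
    forall A : set VV, measurable A ->
      g1 A = pushforward mu (fun x => (x, f x)) A /\
      g2 A = pushforward mu (fun x => (x, f x)) A.
Proof.
move=> ac o1 o2; have [m mE mI] := exists_midpoint g1 g2.
have om : optimal_coupling mu nu m.
  apply: (optimal_midpoint o1 o2 mE); apply: mI.
    by apply: measurable_sqdist; [exact: measurable_fst|exact: measurable_snd].
  by move=> p; rewrite lee_fin sqr_ge0.
have [f mf fE] := supp_graph m.
have m0 := multivalued_null ac om.
have [mS] := setC_supp_measurable_null m.
rewrite mE => /eqP; rewrite mule_eq0 eqe invr_eq0 pnatr_eq0/=.
rewrite padde_eq0// => /andP[/eqP s1 /eqP s2].
exists f => // A mA; split.
  exact: (concentrated_graph o1.1 mf m0 s1 fE mA).
exact: (concentrated_graph o2.1 mf m0 s2 fE mA).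
Qed.

End brenier.

(** * Quadratic integrals of vector fields *)

Section L2_fields.
Context {R : realType} {d : nat}.
Local Notation V := 'rV[R]_d.
Context d0 (T : measurableType d0) (mu : {measure set T -> \bar R}).
Implicit Types u v : T -> V.

Lemma measurable_sqnorm u : measurable_fun [set: T] u ->
  measurable_fun [set: T] (fun x => (enorm (u x) ^+ 2)%:E).
Proof.
move=> mu'; apply/measurable_EFinP; under eq_fun do rewrite sqr_enorm.
exact: measurable_dotp.
Qed.

Lemma sqnorm_integrable u : measurable_fun [set: T] u ->
  (\int[mu]_x (enorm (u x) ^+ 2)%:E < +oo)%E ->
  mu.-integrable [set: T] (fun x => (enorm (u x) ^+ 2)%:E).
Proof.
move=> mu' uoo; apply/integrableP; split; first exact: measurable_sqnorm.
under eq_integral do rewrite gee0_abs ?lee_fin ?sqr_ge0//.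
exact: uoo.
Qed.

Lemma dotp_integrable u v : measurable_fun [set: T] u ->
  measurable_fun [set: T] v ->
  (\int[mu]_x (enorm (u x) ^+ 2)%:E < +oo)%E ->
  (\int[mu]_x (enorm (v x) ^+ 2)%:E < +oo)%E ->
  mu.-integrable [set: T] (fun x => (dotp (u x) (v x))%:E).
Proof.
move=> mu' mv uoo voo.
have iu := sqnorm_integrable mu' uoo; have iv := sqnorm_integrable mv voo.
apply: (@le_integrable _ _ _ _ _ _ _ (fun x => ((2^-1)%:E *
  ((enorm (u x) ^+ 2)%:E + (enorm (v x) ^+ 2)%:E))%E)) => //.
- by apply/measurable_EFinP; exact: measurable_dotp.
- move=> x _; rewrite -EFinD -EFinM !abse_EFin lee_fin !sqr_enorm.
  by rewrite mulrC; apply: (le_trans (normr_dotp_le _ _)); exact: ler_norm.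
- by apply: integrableZl => //; exact: integrableD.
Qed.

Lemma integral_sqnorm_combination (u v : T -> V) (t : R) :
  measurable_fun [set: T] u -> measurable_fun [set: T] v ->
  (\int[mu]_x (enorm (u x) ^+ 2)%:E < +oo)%E ->
  (\int[mu]_x (enorm (v x) ^+ 2)%:E < +oo)%E ->
  (\int[mu]_x (enorm (u x - t *: v x) ^+ 2)%:E =
   \int[mu]_x (enorm (u x) ^+ 2)%:E
   + (- 2 * t)%:E * \int[mu]_x (dotp (u x) (v x))%:E
   + (t ^+ 2)%:E * \int[mu]_x (enorm (v x) ^+ 2)%:E)%E.
Proof.
move=> mu' mv uoo voo.
have iu := sqnorm_integrable mu' uoo; have iv := sqnorm_integrable mv voo.
have iuv := dotp_integrable mu' mv uoo voo.
have i2 := integrableZl measurableT (- 2 * t) iuv.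
have i3 := integrableZl measurableT (t ^+ 2) iv.
rewrite -(integralZl measurableT iuv) -(integralZl measurableT iv).
rewrite -(integralD measurableT iu i2).
rewrite -(integralD measurableT (integrableD measurableT iu i2) i3).
apply: eq_integral => x _; rewrite -!EFinM -!EFinD; congr EFin.
by rewrite !sqr_enorm !dotpE (dotpC (v x)); ring.
Qed.

Lemma integral_sqnormB_le (u v : T -> V) :
  measurable_fun [set: T] u -> measurable_fun [set: T] v ->
  (\int[mu]_x (enorm (u x - v x) ^+ 2)%:E <=
   2%:E * \int[mu]_x (enorm (u x) ^+ 2)%:E
   + 2%:E * \int[mu]_x (enorm (v x) ^+ 2)%:E)%E.
Proof.
move=> mu' mv.
have msu := measurable_sqnorm mu'; have msv := measurable_sqnorm mv.
have ge0 (w : T -> V) x : (0 <= (enorm (w x) ^+ 2)%:E)%E by rewrite lee_fin sqr_ge0.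
have ge02 (w : T -> V) x : (0 <= 2%:E * (enorm (w x) ^+ 2)%:E)%E.
  by rewrite mule_ge0.
rewrite -!ge0_integralZl_EFin//.
rewrite -ge0_integralD//; [|exact: measurable_funeM|exact: measurable_funeM].
apply: ge0_le_integral => //.
- by move=> x _; rewrite lee_fin sqr_ge0.
- exact: measurable_sqnorm (measurable_subV mu' mv).
- by apply: emeasurable_funD; exact: measurable_funeM.
- move=> x _; rewrite -!EFinM -EFinD lee_fin !sqr_enorm.
  have := dotp_ge0 (u x + v x); rewrite !dotpE (dotpC (v x) (u x)).
  by move: (dotp (u x) (u x)) (dotp (v x) (v x)) (dotp _ _) => a b c; lra.
Qed.

Lemma L2normE (xi : V -> V) (m : {measure set V -> \bar R}) :
  Lnorm m 2%:E (fun x => (enorm (xi x))%:E) =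
  sqrte (\int[m]_x (enorm (xi x) ^+ 2)%:E).
Proof.
rewrite unlock poweR12_sqrt; last first.
  by apply: integral_ge0 => x _; exact: poweR_ge0.
congr sqrte; apply: eq_integral => x _.
rewrite abse_EFin poweR_EFin powR_mulrn// real_normK//.
exact: num_real.
Qed.

End L2_fields.

(** * Couplings induced by maps *)

Section couplings_from_maps.
Context {R : realType} {d : nat}.
Local Notation V := 'rV[R]_d.
Local Notation VV := (V * V)%type.
Implicit Types (mu nu : P2 R d).

(** The law of [(f, h)] under [mu] is a coupling; with a common source [mu], no gluing of plans is
    necessary. *)
Lemma W2_sqr_le_maps mu (alpha beta : P2 R d) (f h : V -> V) :
  measurable_fun [set: V] f -> measurable_fun [set: V] h ->
  (forall A, measurable A -> alpha A = pushforward mu f A) ->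
  (forall A, measurable A -> beta A = pushforward mu h A) ->
  (W2 alpha beta ^+ 2 <= \int[mu]_x (enorm (f x - h x) ^+ 2)%:E)%E.
Proof.
move=> mf mh af bh.
have mfh : measurable_fun [set: V] (fun x => (f x, h x)).
  exact: measurable_fun_pair.
have [g gE] := exists_pushforward mu mfh.
have cg : coupling alpha beta g.
  by move=> A mA; rewrite /pushforward !gE af// bh.
apply: (le_trans (W2_sqr_le cg)).
rewrite /cost2 (@ge0_integral_map _ _ _ _ _ mu g _ _ mfh)//.
- by move=> A _; exact: gE.
- by apply: measurable_sqdist; [exact: measurable_fst|exact: measurable_snd].
- by move=> p; rewrite lee_fin sqr_ge0.
Qed.

Lemma W2_diag mu : (W2 mu mu ^+ 2 = 0)%E.
Proof.
apply/eqP; rewrite eq_le; apply/andP; split; last first.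
  by rewrite expe2 mule_ge0 ?W2_ge0.
apply: (le_trans (@W2_sqr_le_maps mu mu mu id id _ _ _ _)) => //.
rewrite integral0_eq// => x _.
by rewrite subrr sqr_enorm /dotp big1// => i _; rewrite mxE mul0r.
Qed.

Section transport_maps.
Variables (mu nu : P2 R d) (f : V -> V).
Hypothesis tf : is_transport_map mu nu f.

Lemma transport_map_measurable : measurable_fun [set: V] f.
Proof. by case: tf. Qed.

Lemma transport_map_pushforward A : measurable A -> nu A = pushforward mu f A.
Proof.
move=> mA; have [mf [g [cg _] gE]] := tf.
have [_ <-] := cg A mA; rewrite /pushforward gE//.
by rewrite -[X in measurable X]setTI; exact: measurable_snd.
Qed.

Lemma transport_map_cost :
  (\int[mu]_x (enorm (f x - x) ^+ 2)%:E = W2 mu nu ^+ 2)%E.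
Proof.
have [mf [g og gE]] := tf.
rewrite (W2_sqr og) /cost2 (@ge0_integral_map _ _ _ _ _ mu g (fun x => (x, f x))).
- apply: eq_integral => x _ /=; rewrite !sqr_enorm -opprB dotpNl dotpNr opprK.
  by [].
- exact: measurable_fun_pair.
- exact: gE.
- by apply: measurable_sqdist; [exact: measurable_fst|exact: measurable_snd].
- by move=> p; rewrite lee_fin sqr_ge0.
Qed.

Lemma transport_map_cost_lty :
  (\int[mu]_x (enorm (f x - x) ^+ 2)%:E < +oo)%E.
Proof.
have [_ [g og _]] := tf.
by rewrite transport_map_cost (W2_sqr og) (cost2_lty og.1).
Qed.

End transport_maps.
End couplings_from_maps.

(** * Proximal step and error bounds *)

(** The passage to the limit [t -> 0] in the variation of the proximal problem. *)
Lemma le_of_le_linear (R : realFieldType) (K p q : R) : (0 <= K) ->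
  (forall t, 0 < t <= 1 -> p <= q + t * K) -> p <= q.
Proof.
move=> K0 H; apply/ler_addgt0Pr => e e0.
have K1 : (0 < K + 1) by lra.
have t0 : (0 < Num.min 1 (e / (K + 1))) by rewrite lt_min ltr01 divr_gt0.
apply: (le_trans (H (Num.min 1 (e / (K + 1))) _)); first by rewrite t0 ge_min lexx.
rewrite lerD2l; apply: (@le_trans _ _ (e / (K + 1) * K)).
  by rewrite ler_wpM2r// ge_min lexx orbT.
by rewrite mulrAC ler_pdivrMr//; nra.
Qed.

Section proximal.
Local Open Scope ereal_scope.
Context {R : realType} {d : nat}.
Local Notation V := 'rV[R]_d.
Local Notation VV := (V * V)%type.
Variable Phi : P2 R d -> \bar R.
Hypothesis Phi_gtNy : forall mu : P2 R d, -oo < Phi mu.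
Hypothesis Phi_convex : geodesically_convex Phi.
Hypothesis Phi_ac : forall mu : P2 R d, dom Phi mu -> absolutely_continuous mu.
Implicit Types mu nu : P2 R d.

Lemma dom_fin_num mu : dom Phi mu -> Phi mu \is a fin_num.
Proof. by move=> dmu; rewrite fin_real// Phi_gtNy. Qed.

Lemma exists_optimal mu nu : exists g, optimal_coupling mu nu g.
Proof. by have [_ [g og _] _] := Phi_convex mu nu; exists g. Qed.

Lemma W2_fin_num mu nu : W2 mu nu \is a fin_num.
Proof.
have [g [cg <-]] := exists_optimal mu nu.
by rewrite sqrte_fin_num ?cost2_ge0// (cost2_fin cg).
Qed.

Lemma transport_mapP mu nu : dom Phi mu ->
  is_transport_map mu nu (transport_map mu nu).
Proof.
move=> dmu; have [g og] := exists_optimal mu nu.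
have [f mf fE] := optimal_map_unique (Phi_ac dmu) og og.
apply: (@xgetPex _ _ (is_transport_map mu nu)); exists f; split => //.
by exists g => // A /fE[].
Qed.

(** Convexity comes with some geodesic and its own optimal plan; uniqueness identifies this plan
    with the one induced by [transport_map]. *)
Lemma convex_along_transport_map mu nu (t : R) : dom Phi mu ->
  (0 <= t <= 1)%R ->
  exists2 rho : P2 R d,
    (forall A, measurable A -> rho A = pushforward mu
      (fun x => (1 - t) *: x + t *: transport_map mu nu x)%R A) &
    Phi rho <= (1 - t)%:E * Phi mu + t%:E * Phi nu.
Proof.
move=> dmu t01; have [gam [g og gE] gconv] := Phi_convex mu nu.
exists (gam t); last exact: gconv.
move=> A mA; rewrite gE//.
have [mT [g' og' g'E]] := transport_mapP nu dmu.
have [f _ fE] := optimal_map_unique (Phi_ac dmu) og og'.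
have mB : measurable ((fun p : VV => (1 - t) *: p.1 + t *: p.2)%R @^-1` A).
  rewrite -[X in measurable X]setTI.
  suff : measurable_fun [set: VV] (fun p : VV => (1 - t) *: p.1 + t *: p.2)%R by apply.
  by apply: measurable_addV; apply: measurable_scaleV;
    [exact: measurable_fst|exact: measurable_snd].
have [e1 e2] := fE _ mB.
by rewrite /pushforward e1 -e2 g'E.
Qed.

Section prox_step.
Variables (tau : R) (mu0 mu1 : P2 R d).
Hypothesis tau_gt0 : (0 < tau)%R.
Hypothesis dom_mu0 : dom Phi mu0.
Hypothesis prox_mu1 : prox Phi tau mu0 mu1.

Lemma prox_decrease :
  Phi mu1 + ((2 * tau)^-1)%:E * W2 mu1 mu0 ^+ 2 <= Phi mu0.
Proof. by have := prox_mu1 mu0; rewrite W2_diag mule0 adde0. Qed.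

Lemma prox_dom : dom Phi mu1.
Proof.
rewrite /dom/=; apply: le_lt_trans dom_mu0; apply: le_trans prox_decrease.
by rewrite leeDl// mule_ge0// ?expe2 ?mule_ge0 ?W2_ge0// lee_fin invr_ge0 mulr_ge0// ltW.
Qed.

Let S := transport_map mu1 mu0.
Let xi : V -> V := fun x => (tau^-1 *: (S x - x))%R.

Let tS : is_transport_map mu1 mu0 S.
Proof. exact/transport_mapP/prox_dom. Qed.

Let mS1 : measurable_fun [set: V] (fun x => S x - x)%R.
Proof. by apply: measurable_subV => //; exact: transport_map_measurable tS. Qed.

Lemma prox_subgradient_norm :
  L2norm mu1 xi = (tau^-1)%:E * W2 mu1 mu0.
Proof.
rewrite /L2norm L2normE.
have -> : \int[mu1]_x (enorm (xi x) ^+ 2)%:E =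
    ((tau^-1)%:E * W2 mu1 mu0) ^+ 2.
  rewrite expe2 muleACA -[X in _ * X]expe2 -(transport_map_cost tS) -EFinM.
  rewrite -ge0_integralZl_EFin//.
  - apply: eq_integral => x _.
    by rewrite -EFinM !sqr_enorm /xi dotpZl dotpZr mulrA.
  - by move=> x _; rewrite lee_fin sqr_ge0.
  - exact: measurable_sqnorm.
  - by rewrite mulr_ge0// invr_ge0 ltW.
by rewrite sqrte_sqr gee0_abs// mule_ge0 ?W2_ge0// lee_fin invr_ge0 ltW.
Qed.

(** The competitor is the point at time [t] of the geodesic from [mu1] to [nu]. Its distance to
    [mu0] is estimated by coupling [(1 - t) id + t T] with [S], both over [mu1], and the square is
    expanded in [t]. *)
Lemma prox_variation nu (t : R) : dom Phi nu -> (0 <= t <= 1)%R ->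
  Phi mu1 + ((2 * tau)^-1)%:E * W2 mu1 mu0 ^+ 2 <=
  (1 - t)%:E * Phi mu1 + t%:E * Phi nu + ((2 * tau)^-1)%:E *
   (W2 mu1 mu0 ^+ 2 + (- 2 * t)%:E *
      \int[mu1]_x (dotp (S x - x) (transport_map mu1 nu x - x))%:E +
   (t ^+ 2)%:E * W2 mu1 nu ^+ 2).
Proof.
move=> dnu t01.
have tT := transport_mapP nu prox_dom.
have mT1 : measurable_fun [set: V] (fun x => transport_map mu1 nu x - x)%R.
  by apply: measurable_subV => //; exact: transport_map_measurable tT.
have [rho rhoE rho_le] := convex_along_transport_map nu prox_dom t01.
apply: (le_trans (prox_mu1 rho)); apply: leeD => //.
apply: lee_wpmul2l; first by rewrite lee_fin invr_ge0 mulr_ge0// ltW.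
rewrite -(transport_map_cost tS) -(transport_map_cost tT).
rewrite -integral_sqnorm_combination//;
  [|exact: transport_map_cost_lty tS|exact: transport_map_cost_lty tT].
apply: (le_trans (W2_sqr_le_maps _ (transport_map_measurable tS) rhoE
   (transport_map_pushforward tS))).
  apply: measurable_addV; apply: measurable_scaleV => //.
  exact: transport_map_measurable tT.
rewrite le_eqVlt; apply/orP; left; apply/eqP; apply: eq_integral => x _.
congr (_ %:E); rewrite -/S; set u := S x; set v := transport_map _ _ x.
rewrite !sqr_enorm -opprB dotpNl dotpNr opprK.
by congr (dotp _ _); apply/rowP => i; rewrite !mxE; ring.
Qed.

Lemma prox_subgradient : subdifferential Phi mu1 xi.
Proof.
have mxi : measurable_fun [set: V] xi by exact: measurable_scaleV.
split; first exact: prox_dom.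
  split=> //; rewrite prox_subgradient_norm.
  by rewrite ltey_eq fin_numM// W2_fin_num.
move=> nu; have [dnu|] := boolP (Phi nu < +oo); last first.
  by rewrite -leNgt leye_eq => /eqP ->; rewrite leey.
have tT := transport_mapP nu prox_dom.
have mT1 : measurable_fun [set: V] (fun x => transport_map mu1 nu x - x)%R.
  by apply: measurable_subV => //; exact: transport_map_measurable tT.
have iI := dotp_integrable mS1 mT1 (transport_map_cost_lty tS)
  (transport_map_cost_lty tT).
have -> : \int[mu1]_x (dotp (xi x) (transport_map mu1 nu x - x))%:E =
    (tau^-1)%:E * \int[mu1]_x (dotp (S x - x) (transport_map mu1 nu x - x))%:E.
  rewrite -integralZl//; apply: eq_integral => x _.
  by rewrite -EFinM /xi dotpZl.
have := fun t => @prox_variation nu t dnu.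
have Ifin := integrable_fin_num measurableT iI.
have := dom_fin_num prox_dom; have := dom_fin_num dnu.
have : W2 mu1 mu0 ^+ 2 \is a fin_num by rewrite expe2 fin_numM// W2_fin_num.
have : W2 mu1 nu ^+ 2 \is a fin_num by rewrite expe2 fin_numM// W2_fin_num.
have : 0 <= W2 mu1 nu ^+ 2 by rewrite expe2 mule_ge0// W2_ge0.
move: (\int[mu1]_x _) Ifin => I.
move: (W2 mu1 nu ^+ 2) (W2 mu1 mu0 ^+ 2) (Phi mu1) (Phi nu) I => W U p q I.
case: I => [I| |] // _; case: W => [W| |] // W0 _.
case: U => [U| |] // _; case: q => [q| |] // _; case: p => [p| |] // _.
rewrite lee_fin in W0 => H.
rewrite -!EFinM -!EFinD lee_fin.
have k0 : (0 < (2 * tau)^-1)%R by rewrite invr_gt0 mulr_gt0.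
have tk : (tau^-1 = 2 * (2 * tau)^-1)%R by rewrite invfM mulrA divff// mul1r.
move: ((2 * tau)^-1)%R k0 tk H => k k0 -> H.
(* After cancelling [k * U] and dividing by [t], the quadratic term leaves the remainder
   [t * (k * W)]. *)
apply: (@le_of_le_linear _ (k * W)); first by rewrite mulr_ge0// ltW.
move=> t /andP[t0 t1]; have := H t; rewrite (ltW t0) t1 => /(_ isT).
rewrite -?EFinM -?EFinD -?EFinM -?EFinD lee_fin => Ht.
by rewrite -(ler_pM2l t0); lra.
Qed.

End prox_step.

End proximal.

(** * Error bound and quadratic growth *)

Section error_bounds.
Local Open Scope ereal_scope.
Context {R : realType} {d : nat}.
Local Notation V := 'rV[R]_d.
Variable Phi : P2 R d -> \bar R.
Hypothesis Phi_gtNy : forall mu : P2 R d, -oo < Phi mu.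
Hypothesis Phi_convex : geodesically_convex Phi.
Hypothesis Phi_ac : forall mu : P2 R d, dom Phi mu -> absolutely_continuous mu.
Hypothesis Phi_argmin : argmin Phi !=set0.
Implicit Types mu nu : P2 R d.

Local Notation D mu := (W2_set mu (argmin Phi)).

Lemma W2_set_ge0 mu : 0 <= D mu.
Proof. by apply: le_ereal_inf_tmp => _ [nu _ <-]; exact: W2_ge0. Qed.

Lemma W2_set_le mu nu : argmin Phi nu -> D mu <= W2 mu nu.
Proof. by move=> nuM; apply: ereal_inf_lbound; exists nu. Qed.

Lemma W2_set_fin_num mu : D mu \is a fin_num.
Proof.
have [nu nuM] := Phi_argmin.
rewrite ge0_fin_numE ?W2_set_ge0//; apply: le_lt_trans (W2_set_le mu nuM) _.
by rewrite ltey_eq (W2_fin_num Phi_convex).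
Qed.

Lemma inf_argmin nu : argmin Phi nu -> ereal_inf (range Phi) = Phi nu.
Proof.
move=> nuM; apply/eqP; rewrite eq_le; apply/andP; split.
  by apply: ereal_inf_lbound; exists nu.
by apply: le_ereal_inf_tmp => _ [rho _ <-]; exact: nuM.
Qed.

(** Passes to the infimum without a nearest minimizer: the root of [a/b], cut off at 0 to allow
    negative [a], is a lower bound of all the distances. *)
Lemma le_W2_set_sqr mu (a b : R) : (0 < b)%R ->
  (forall nu, argmin Phi nu -> a%:E <= b%:E * W2 mu nu ^+ 2) ->
  a%:E <= b%:E * D mu ^+ 2.
Proof.
move=> b0 H; pose s := Num.sqrt (Num.max 0%R (a / b)%R).
have sqr_s : (s ^+ 2 = Num.max 0%R (a / b))%R by rewrite sqr_sqrtr// le_max lexx.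
have : s%:E <= D mu.
  apply: le_ereal_inf_tmp => _ [nu /H + <-].
  have := W2_ge0 mu nu; have := W2_fin_num Phi_convex mu nu.
  case: (W2 mu nu) => [w| |] // _; rewrite expe2 -!EFinM -expr2 !lee_fin => w0 aw.
  rewrite -(@ler_pXn2r _ 2)// ?nnegrE ?sqrtr_ge0// sqr_s ge_max sqr_ge0/=.
  by rewrite ler_pdivrMr// mulrC.
have := W2_set_fin_num mu.
case: (D mu) => [w| |] // _; rewrite expe2 -!EFinM -expr2 !lee_fin => sw.
rewrite mulrC -ler_pdivrMr//.
apply: (@le_trans _ _ (s ^+ 2)%R); first by rewrite sqr_s le_max lexx orbT.
by rewrite ler_pXn2r ?nnegrE ?sqrtr_ge0// (le_trans _ sw)// sqrtr_ge0.
Qed.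

(** The transport maps from [mu] to both measures couple them, and
    [|S - T|^2 <= 2|S - id|^2 + 2|T - id|^2]. *)
Lemma W2_sqr_triangle mu alpha beta : dom Phi mu ->
  W2 alpha beta ^+ 2 <= 2%:E * W2 mu alpha ^+ 2 + 2%:E * W2 mu beta ^+ 2.
Proof.
move=> dmu.
have tS := transport_mapP Phi_convex Phi_ac alpha dmu.
have tT := transport_mapP Phi_convex Phi_ac beta dmu.
have mS := transport_map_measurable tS; have mT := transport_map_measurable tT.
apply: (le_trans (W2_sqr_le_maps mS mT (transport_map_pushforward tS)
  (transport_map_pushforward tT))).
rewrite -(transport_map_cost tS) -(transport_map_cost tT).
have := integral_sqnormB_le mu (measurable_subV mS (@measurable_id _ _ setT))
  (measurable_subV mT (@measurable_id _ _ setT)).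
apply: le_trans; rewrite le_eqVlt; apply/orP; left; apply/eqP.
by apply: eq_integral => x _; rewrite opprB addrA subrK.
Qed.

(** For the constant: with [w] the length of the step, the squared distance from [mu0] is at most
    [2 w^2 + 2 (kappa/tau)^2 w^2], while the decrease of [Phi] is at least [w^2 / (2 tau)]. *)
Lemma growth_of_error_bound (tau kappa : R) : (0 < tau)%R -> (0 < kappa)%R ->
  (forall mu, dom Phi mu -> prox Phi tau mu !=set0) ->
  (forall mu, D mu <= kappa%:E * dist0_subdifferential Phi mu) ->
  forall mu, ereal_inf (range Phi) +
    ((4 * tau * (1 + (kappa * tau^-1) ^+ 2))^-1)%:E * D mu ^+ 2 <= Phi mu.
Proof.
move=> tau0 kappa0 prox_ne EB mu0.
have [dmu0|] := boolP (Phi mu0 < +oo); last first.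
  by rewrite -leNgt leye_eq => /eqP ->; rewrite leey.
have [mu1 pmu1] := prox_ne _ dmu0.
have decr := prox_decrease pmu1.
have dmu1 := prox_dom tau0 dmu0 pmu1.
have xiS := prox_subgradient Phi_gtNy Phi_convex Phi_ac tau0 dmu0 pmu1.
have xiN := prox_subgradient_norm Phi_convex Phi_ac tau0 dmu0 pmu1.
have D1 : D mu1 <= (kappa * tau^-1)%:E * W2 mu1 mu0.
  apply: (le_trans (EB mu1)); rewrite EFinM -muleA -xiN.
  apply: lee_wpmul2l; first by rewrite lee_fin ltW.
  by apply: ereal_inf_lbound; eexists; [exact: xiS|].
have D0 nu : argmin Phi nu ->
    D mu0 ^+ 2 <= 2%:E * W2 mu1 mu0 ^+ 2 + 2%:E * W2 mu1 nu ^+ 2.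
  move=> nuM; apply: le_trans (W2_sqr_triangle mu0 nu dmu1).
  by rewrite !expe2; apply: lee_pmul; rewrite ?W2_set_ge0// W2_set_le.
have [nu0 nu0M] := Phi_argmin; rewrite (inf_argmin nu0M).
have := dom_fin_num Phi_gtNy dmu0; have := dom_fin_num Phi_gtNy dmu1.
have nu0mu1 := nu0M mu1.
have : Phi nu0 \is a fin_num.
  by apply: (dom_fin_num Phi_gtNy); exact: le_lt_trans nu0mu1 dmu1.
have two0 : (0 < 2 :> R)%R by [].
have D01 a : (forall nu, argmin Phi nu -> a%:E <= 2%:E * W2 mu1 nu ^+ 2) ->
    a%:E <= 2%:E * D mu1 ^+ 2 by exact: le_W2_set_sqr.
move: decr nu0mu1 D1 D0 D01.
have := W2_fin_num Phi_convex mu1 mu0; have := W2_ge0 mu1 mu0.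
have := W2_set_fin_num mu0; have := W2_set_fin_num mu1; have := W2_set_ge0 mu1.
case: (D mu0) => [d0| |] //; case: (D mu1) => [d1| |] // d10 _ _.
case: (W2 mu1 mu0) => [w| |] // w0 _; case: (Phi mu0) => [p0| |] //.
case: (Phi mu1) => [p1| |] //; case: (Phi nu0) => [m| |] //.
rewrite !expe2 -!EFinM -!expr2 -!EFinD.
rewrite lee_fin => decr; rewrite lee_fin => mp1; rewrite lee_fin => D1 D0 D01 _ _ _.
rewrite lee_fin in d10; rewrite lee_fin in w0.
have key : (d0 ^+ 2 - 2 * w ^+ 2 <= 2 * d1 ^+ 2)%R.
  rewrite -lee_fin; apply: D01 => nu nuM.
  by rewrite EFinB leeBlDr// addeC EFinM; have := D0 nu nuM; rewrite expr2 EFinM.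
have d1w : (d1 ^+ 2 <= (kappa * tau^-1) ^+ 2 * w ^+ 2)%R.
  have kt0 : (0 <= kappa * tau^-1)%R by rewrite divr_ge0 ?ltW.
  by rewrite -exprMn ler_pXn2r// nnegrE mulr_ge0.
rewrite lee_fin; apply: le_trans decr; apply: lerD => //.
have K0 : (0 < 1 + (kappa * tau^-1) ^+ 2)%R by rewrite ltr_pwDl// sqr_ge0.
rewrite mulrC ler_pdivrMr; last by rewrite !mulr_gt0.
rewrite [leRHS](_ : _ = 2 * (1 + (kappa * tau^-1) ^+ 2) * w ^+ 2)%R.
  lra.
move: (1 + (kappa * tau^-1) ^+ 2)%R => z.
by field; rewrite gt_eqF.
Qed.

(** Let [r] be the distance to the minimizers, [w] the distance to one of them, [n] the squared norm
    of [xi] and [I] the slope term. Growth and the subgradient inequality give [c r^2 <= - I], and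
    the square gives [- 2 c I <= n + c^2 w^2]. The infimum over minimizers replaces [w] by [r],
    leaving [c^2 r^2 <= n]. *)
Lemma error_bound_of_growth (c : R) : (0 < c)%R ->
  (forall mu, ereal_inf (range Phi) + c%:E * D mu ^+ 2 <= Phi mu) ->
  forall mu, D mu <= (c^-1)%:E * dist0_subdifferential Phi mu.
Proof.
move=> c0 QG mu.
rewrite lee_pdivlMl//; apply: le_ereal_inf_tmp => _ [xi [dmu [mxi xioo] sub] <-].
have : L2norm mu xi = sqrte (\int[mu]_x (enorm (xi x) ^+ 2)%:E).
  by rewrite /L2norm L2normE.
set N2 := \int[mu]_x _ => NE.
have N20 : 0 <= N2 by apply: integral_ge0 => x _; rewrite lee_fin sqr_ge0.
have N2fin : N2 \is a fin_num.
  by rewrite -(sqrte_fin_num N20) -NE ge0_fin_numE// NE sqrte_ge0.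
have N2oo : N2 < +oo by rewrite ltey_eq N2fin.
have key nu : argmin Phi nu -> 2%:E * ((c ^+ 2)%:E * D mu ^+ 2) - N2 <=
    (c ^+ 2)%:E * W2 mu nu ^+ 2.
  move=> nuM.
  have tT := transport_mapP Phi_convex Phi_ac nu dmu.
  have mT1 := measurable_subV (transport_map_measurable tT) (@measurable_id _ _ setT).
  have Too := transport_map_cost_lty tT.
  (* The square completed here is that of [xi + c (T - id)]. *)
  have := integral_sqnorm_combination (- c)%R mxi mT1 N2oo Too.
  rewrite (transport_map_cost tT) -/N2.
  have := integrable_fin_num measurableT (dotp_integrable mxi mT1 N2oo Too).
  have := sub nu.
  move: (\int[mu]_x (dotp (xi x) (transport_map mu nu x - x))%:E) => I.
  have := QG mu; rewrite (inf_argmin nuM).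
  have J0 : 0 <= \int[mu]_x (enorm (xi x - - c *: (transport_map mu nu x - x)) ^+ 2)%:E.
    by apply: integral_ge0 => x _; rewrite lee_fin sqr_ge0.
  move: (\int[mu]_x _) J0 => J.
  have := dom_fin_num Phi_gtNy dmu.
  have : Phi nu \is a fin_num.
    by apply: (dom_fin_num Phi_gtNy); exact: le_lt_trans (nuM mu) dmu.
  have := W2_set_fin_num mu; have := W2_fin_num Phi_convex mu nu.
  move: N2fin; clear -c0; move: N2 => N2.
  case: (W2 mu nu) => [w| |] //; case: (D mu) => [r| |] //.
  case: (Phi nu) => [m| |] //; case: (Phi mu) => [p| |] //.
  case: N2 => [n| |] // _ _ _ _ _ J0; case: I => [I| |] //; try by move=> ? ?.
  rewrite !expe2 -!EFinM -!expr2 -!EFinD lee_fin => growth.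
  rewrite lee_fin => slope _ JE; move: J0; rewrite JE lee_fin => J0.
  rewrite lee_fin; nra.
have c20 : (0 < c ^+ 2)%R by rewrite exprn_gt0.
have lem a := @le_W2_set_sqr mu a _ c20.
rewrite NE; move: N2 N20 N2fin key {NE N2oo} => [n| |] // n0 _.
rewrite lee_fin in n0.
have := W2_set_fin_num mu; have := W2_set_ge0 mu.
move: lem; case: (D mu) => [r| |] // lem r0 _ key.
rewrite lee_fin in r0.
have := lem (2 * (c ^+ 2 * r ^+ 2) - n)%R.
rewrite expe2 -?EFinM -expr2 lee_fin => h.
have {}h : (2 * (c ^+ 2 * r ^+ 2) - n <= c ^+ 2 * r ^+ 2)%R.
  by apply: h => nu nuM; have := key nu nuM; rewrite expe2 -?EFinM -expr2.
rewrite -?EFinM /= lee_fin -(@ler_pXn2r _ 2)// ?nnegrE ?sqrtr_ge0//.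
  by rewrite sqr_sqrtr// exprMn; lra.
by rewrite mulr_ge0// ltW.
Qed.

End error_bounds.

Local Open Scope ereal_scope.

(* [Phi_wd] says that Phi is a function of the Borel measure (see P2), and
   [Phi_gtNy] that it does not take the value -oo. *)
Theorem theorem3p3 (R : realType) (d : nat) (Phi : P2 R d -> \bar R)
  (Phi_wd : forall mu nu : P2 R d, measure_eq mu nu -> Phi mu = Phi nu)
  (Phi_gtNy : forall mu : P2 R d, -oo < Phi mu)
  (Phi_proper : dom Phi !=set0)
  (Phi_convex : geodesically_convex Phi)
  (Phi_ac : forall mu : P2 R d, dom Phi mu -> absolutely_continuous mu)
  (Phi_argmin : argmin Phi !=set0)
  (Phi_prox : exists2 tau : R, (0 < tau)%R &
     forall mu : P2 R d, dom Phi mu -> prox Phi tau mu !=set0) :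
  (exists2 kappa : R, (0 < kappa)%R &
     forall mu : P2 R d,
       W2_set mu (argmin Phi) <= kappa%:E * dist0_subdifferential Phi mu)
  <->
  (exists2 c : R, (0 < c)%R &
     forall mu : P2 R d,
       ereal_inf (range Phi) + c%:E * W2_set mu (argmin Phi) ^+ 2 <= Phi mu).
Proof.
split=> [[kappa kappa0 EB]|[c c0 QG]].
  have [tau tau0 prox_ne] := Phi_prox.
  exists (4 * tau * (1 + (kappa * tau^-1) ^+ 2))^-1%R.
    by rewrite invr_gt0 !mulr_gt0// ltr_pwDl// sqr_ge0.
  exact: growth_of_error_bound.
exists c^-1%R; first by rewrite invr_gt0.
exact: error_bound_of_growth.
Qed.
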